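(* Let $m,n\geq1$ be integers with $d=m+n\geq3$ and let $\Theta$ be a real $n\times m$ matrix. Suppose that the group of integer solutions $(\vec x,\vec y)\in\mathbb Z^m\oplus\mathbb Z^n$ of $\Theta\vec x=\vec y$ is not a one-dimensional lattice. Then for $m=1$ we have \[ \mathfrak b_2\geq\frac{\mathfrak b_1+\mathfrak a_1}{1-\mathfrak a_1}, \] and for $m\geq2$ we have \[ \mathfrak b_2\geq\frac{\mathfrak a_1-1}{2+\mathfrak b_1-\mathfrak a_1}\ \text{ if }\ \mathfrak a_1\neq\infty,\qquad\text{and}\qquad \mathfrak b_2\geq\frac{1-\mathfrak a_1^{-1}}{\mathfrak b_1^{-1}+\mathfrak a_1^{-1}}. \]
   Context: Let $\vec e_1,\ldots,\vec e_d$ be the standard basis of $\mathbb R^d$ and let $\boldsymbol\ell_1,\ldots,\boldsymbol\ell_d$ be the columns of the $d\times d$ matrix $\begin{pmatrix}E_m&-{}^t\Theta\\ \Theta&E_n\end{pmatrix}$, where $E_k$ denotes the $k\times k$ identity matrix. For each $q$, $\wedge^q(\mathbb R^d)$ is regarded as a Euclidean space with orthonormal basis $\vec e_{i_1}\wedge\cdots\wedge\vec e_{i_q}$, $1\leq i_1<\cdots<i_q\leq d$, and $|\cdot|$ denotes the sup-norm of coordinates in this basis ($\wedge^0=\mathbb R$). $\wedge^p(\mathbb Z^d)$ denotes the elements with integer coordinates. For $\sigma=\{i_1<\cdots<i_k\}$ set $\vec L_\sigma=\boldsymbol\ell_{i_1}\wedge\cdots\wedge\boldsymbol\ell_{i_k}$,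 $\vec L_\varnothing=1$; $\mathcal J_k$ is the set of $k$-element subsets of $\{1,\ldots,m\}$; $k_0=\max(0,m-p)$. The $p$-th regular (resp. uniform) Diophantine exponent of the second type $\mathfrak b_p$ (resp. $\mathfrak a_p$) is the supremum of real $\gamma$ such that there are arbitrarily large $t$ for which (resp. such that for every sufficiently large $t$) the system $\max_{\sigma\in\mathcal J_k}|\vec L_\sigma\wedge\vec Z|\leq t^{1-(k-k_0)(1+\gamma)}$, $k=0,\ldots,m$, has a nonzero solution $\vec Z\in\wedge^p(\mathbb Z^d)$. *)

(* Defs.v *)
From HB Require Import structures.
From mathcomp Require Import all_boot all_order all_algebra.
From mathcomp Require Import all_classical all_reals all_analysis.

Set Implicit Arguments.
Unset Strict Implicit.
Unset Printing Implicit Defensive.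

Import Order.TTheory GRing.Theory Num.Theory.
Import numFieldNormedType.Exports.

Local Open Scope ring_scope.

(* The whole exterior algebra of R^d, in coordinates: [u S] is the coefficient
   of [e_(i_1) /\ ... /\ e_(i_q)], where [S = {i_1 < ... < i_q}]. The q-th
   exterior power consists of the [u] supported on the [S] with [#|S| = q]. *)
Definition ext (R : realType) (d : nat) := {ffun {set 'I_d} -> R}.

Section ExteriorAlgebra.
Variables (R : realType) (d : nat).
Implicit Types (u v : ext R d) (A B : {set 'I_d}).

Definition inversions A B : nat :=
  #|[pred ij : 'I_d * 'I_d | [&& ij.1 \in A, ij.2 \in B & (ij.2 < ij.1)%N]]|.

(* For disjoint A and B, [e_A /\ e_B = (-1)^(inversions A B) e_(A :|: B)];
   for A and B not disjoint it is 0. *)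
Definition wedge u v : ext R d :=
  [ffun S : {set 'I_d} => \sum_(A in powerset S)
     (-1) ^+ inversions A (S :\: A) * u A * v (S :\: A)].

Definition ext_one : ext R d := [ffun S : {set 'I_d} => (S == finset.set0)%:R].

Definition ext_vec (x : 'cV[R]_d) : ext R d :=
  [ffun S : {set 'I_d} => \sum_(i < d | S == [set i]%SET) x i 0].

Definition ext_norm u : R := \big[Order.max/0]_(S : {set 'I_d}) `|u S|.

Definition ext_int (p : nat) : set (ext R d) :=
  [set u : ext R d |
     (forall S : {set 'I_d}, #|S| != p -> u S = 0) /\
     (forall S : {set 'I_d}, u S \is a Num.int)]%classic.

End ExteriorAlgebra.

Local Open Scope classical_set_scope.

Section Exponents.
Variables (R : realType) (m n : nat) (Theta : 'M[R]_(n, m)).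

Definition ell_mx : 'M[R]_(m + n) := block_mx 1%:M (- Theta^T) Theta 1%:M.

(* The product is taken in increasing order of the indices. *)
Definition Lwedge (sigma : {set 'I_m}) : ext R (m + n) :=
  \big[@wedge R (m + n)/ext_one R (m + n)]_(i in sigma)
    ext_vec (col (lshift n i) ell_mx).

(* Truncated subtraction: this is max(0, m - p). *)
Definition k0 (p : nat) : nat := (m - p)%N.

Definition solvable_at (p : nat) (gamma t : R) : Prop :=
  exists Z : ext R (m + n), [/\ ext_int p Z, Z != 0 &
    forall k : nat, (k <= m)%N ->
      \big[Order.max/0]_(sigma : {set 'I_m} | #|sigma| == k)
        ext_norm (wedge (Lwedge sigma) Z)
      <= t `^ (1 - (k%:R - (k0 p)%:R) * (1 + gamma))].

Definition regular_exponent (p : nat) : \bar R :=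
  ereal_sup [set gamma%:E | gamma in
    [set gamma : R | forall T : R, exists2 t, T < t & solvable_at p gamma t]].

Definition uniform_exponent (p : nat) : \bar R :=
  ereal_sup [set gamma%:E | gamma in
    [set gamma : R | \forall t \near +oo, solvable_at p gamma t]].

Definition integer_solutions : set ('cV[int]_m * 'cV[int]_n) :=
  [set z | Theta *m map_mx intr z.1 = map_mx intr z.2].

End Exponents.

Definition one_dim_lattice (V : zmodType) (G : set V) : Prop :=
  exists2 v : V, v != 0 & G = [set v *~ k | k in [set: int]].

(* Main.v *)
Require Import Defs.
From HB Require Import structures.
From mathcomp Require Import all_boot all_order all_algebra.
From mathcomp Require Import all_classical all_reals all_analysis.
From mathcomp Require Import ring lra zify.

Import Order.TTheory GRing.Theory Num.Theory.
Import numFieldNormedType.Exports.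

Local Open Scope classical_set_scope.
Local Open Scope ring_scope.

(** Up to constants, solvability at p = 1 produces integer vectors z with
    "height" (size of x) at most t and "error" (size of y - Theta x) at most
    t^(-gamma), and for two such vectors the wedge Z = z /\ z' satisfies, for
    |sigma| = m, m - 1 and at most m - 2 respectively,
      |L_sigma /\ Z| << e e',  h e' + e h' + e e',  (h + e) (h' + e').
    This follows by writing z as a combination of the l_i plus a vector
    carrying only the error: any term with too many factors l_i dies.
    Take z primitive from the regular exponent (beta < b_1) and z' from the
    uniform exponent (alpha < a_1), at a parameter just small enough for z' to
    be shorter than z, or just large enough for its error to be smaller; as z
    is primitive, z' is then independent of z. With z' shorter and Y = h(z) the
    choices t = Y^(1 - alpha) for m = 1 and t = Y^(2 + beta - alpha) for m >= 2
    give the first two bounds; with e(z') < e(z) = 1 / S the choice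
    t = S^(1 / alpha + 1 / beta) gives the third. Letting alpha and beta tend
    to a_1 and b_1 concludes. If some nonzero integer vector has error 0, the
    hypothesis provides two independent ones, whose wedge shows b_2 = +oo. *)

(** * Inversion counts: the exponents of the signs in wedge products *)

Section Inversions.
Import mathcomp.boot.fintype mathcomp.boot.finset.
Local Open Scope set_scope.
Variable d : nat.
Implicit Types A B D : {set 'I_d}.

Lemma inversionsE A B :
  inversions A B = (\sum_(i in A) \sum_(j in B) (j < i))%N.
Proof.
rewrite /inversions -sum1_card pair_big big_mkcond [RHS]big_mkcond /=.
apply: eq_bigr => -[i j] _ /=; rewrite inE /=.
by case: (i \in A) => //=; case: (j \in B) => //=; case: (j < i)%N.
Qed.

Lemma inversions_splitr A B D : B \subset D ->
  inversions A D = (inversions A B + inversions A (D :\: B))%N.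
Proof.
move=> /setIidPr BD; rewrite !inversionsE -big_split /=; apply: eq_bigr => i _.
by rewrite (big_setID B) /= BD.
Qed.

Lemma inversions_splitl A B D : B \subset D ->
  inversions D A = (inversions B A + inversions (D :\: B) A)%N.
Proof. by move=> /setIidPr BD; rewrite !inversionsE (big_setID B) /= BD. Qed.

Lemma inversions_set1 (i j : 'I_d) : inversions [set i] [set j] = (j < i)%N.
Proof. by rewrite inversionsE !big_set1. Qed.

End Inversions.

(** * Algebra of the wedge product and bounds for its norm *)

Section Wedge.
Import mathcomp.boot.fintype mathcomp.boot.finset.
Local Open Scope set_scope.
Variables (R : realType) (d : nat).
Implicit Types (u v w : ext R d) (x y : 'cV[R]_d) (S : {set 'I_d}).

Lemma wedgeDl u v w : wedge (u + v) w = wedge u w + wedge v w.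
Proof.
apply/ffunP => S; rewrite !ffunE -big_split; apply: eq_bigr => A _.
by rewrite ffunE mulrDr mulrDl.
Qed.

Lemma wedgeDr u v w : wedge u (v + w) = wedge u v + wedge u w.
Proof.
apply/ffunP => S; rewrite !ffunE -big_split; apply: eq_bigr => A _.
by rewrite ffunE mulrDr.
Qed.

Lemma wedge0r u : wedge u 0 = 0.
Proof. by apply/ffunP => S; rewrite !ffunE big1 // => A _; rewrite ffunE mulr0. Qed.

Lemma wedge0l u : wedge 0 u = 0.
Proof. by apply/ffunP => S; rewrite !ffunE big1 // => A _; rewrite ffunE mulr0 mul0r. Qed.

Lemma wedgeNr u v : wedge u (- v) = - wedge u v.
Proof. by apply/eqP; rewrite -addr_eq0 -wedgeDr addNr wedge0r. Qed.

Lemma wedgeNl u v : wedge (- u) v = - wedge u v.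
Proof. by apply/eqP; rewrite -addr_eq0 -wedgeDl addNr wedge0l. Qed.

Lemma wedge_sumr u (I : finType) (F : I -> ext R d) :
  wedge u (\sum_i F i) = \sum_i wedge u (F i).
Proof. exact: (big_morph _ (wedgeDr u) (wedge0r u)). Qed.

(** Both sides become sums over chains [A \subset D \subset S]; additivity of [inversions] in each
    argument makes the signs agree. *)
Lemma wedgeA u v w : wedge (wedge u v) w = wedge u (wedge v w).
Proof.
apply/ffunP => S; rewrite !ffunE.
under eq_bigr => D _ do rewrite ffunE mulr_sumr mulr_suml.
under [RHS]eq_bigr => D _ do rewrite ffunE mulr_sumr.
rewrite (exchange_big_dep (fun A => A \in powerset S)) /=; last first.
  by move=> D A; rewrite !powersetE => DS AD; exact: subset_trans AD DS.
apply: eq_bigr => A; rewrite powersetE => AS.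
(* A set [D] between [A] and [S] corresponds to [B = D :\: A], a subset of [S] disjoint from [A]. *)
rewrite (reindex_onto (fun B => A :|: B) (fun D => D :\: A)) /=; last first.
  move=> D; rewrite !powersetE => /andP[_ AD].
  by rewrite setDE setUIr setUCr setIT; exact/setUidPr.
apply: eq_big => [B|B].
  rewrite !powersetE subsetUl andbT subUset AS /= subsetD setDUl setDv set0U.
  by congr (_ && _); apply/eqP/setDidPl.
rewrite !powersetE => /andP[/andP[ABS _] /eqP AB].
have BSA : B \subset S :\: A.
  by rewrite -AB; exact: setSD.
rewrite AB -setDDl [in LHS](inversions_splitl _ _ _ _ (subsetUl A B)) AB.
rewrite (inversions_splitr _ _ _ _ BSA) !exprD.
by ring.
Qed.

Lemma vec_wedgeE x u S :
  wedge (ext_vec x) u S =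
  \sum_(i in S) (-1) ^+ inversions [set i] (S :\ i) * x i 0 * u (S :\ i).
Proof.
rewrite ffunE.
under eq_bigr => A _ do rewrite ffunE mulr_sumr mulr_suml.
rewrite (exchange_big_dep (mem S)) /=; last first.
  by move=> A i; rewrite powersetE => AS /eqP AE; move: AS; rewrite AE sub1set.
apply: eq_bigr => i iS; rewrite (big_pred1 [set i]) // => A /=.
by rewrite powersetE andb_idl // => /eqP ->; rewrite sub1set.
Qed.

Lemma wedge_vecE x u S :
  wedge u (ext_vec x) S =
  \sum_(i in S) (-1) ^+ inversions (S :\ i) [set i] * u (S :\ i) * x i 0.
Proof.
rewrite ffunE.
under eq_bigr => A _ do rewrite ffunE mulr_sumr.
rewrite (exchange_big_dep (mem S)) /=; last first.
  by move=> A i _ /eqP/setP/(_ i); rewrite !inE eqxx => /andP[].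
apply: eq_bigr => i iS; rewrite (big_pred1 (S :\ i)) ?setDDr ?setDv ?set0U; last first.
  move=> A /=; rewrite powersetE; apply/andP/eqP => [[AS /eqP SA]|->].
    by rewrite -SA setDDr setDv set0U; apply/esym/setIidPr.
  rewrite subD1set; split=> //; rewrite setDDr setDv set0U.
  by apply/eqP/setIidPr; rewrite sub1set.
by rewrite (setIidPr _) // sub1set.
Qed.

Lemma wedge_vecsE x y S :
  wedge (ext_vec x) (ext_vec y) S =
  \sum_i \sum_(j | (i != j) && (S == [set i; j]))
    (-1) ^+ (j < i)%N * x i 0 * y j 0.
Proof.
rewrite vec_wedgeE big_mkcond; apply: eq_bigr => i _.
have E j : (i != j) && (S == [set i; j]) = (i \in S) && (S :\ i == [set j]).
  apply/andP/andP => [[ij /eqP ->]|[iS /eqP SE]].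
    rewrite !inE eqxx; split=> //; apply/eqP/setP => k; rewrite !inE.
    by case: eqP => //= ->; rewrite (negbTE ij).
  rewrite -SE setD1K //; split=> //.
  by apply/eqP => ij; have /setP/(_ i) := SE; rewrite !inE ij eqxx.
case: ifPn => iS; last by rewrite big_pred0 // => j; rewrite E (negbTE iS).
rewrite ffunE mulr_sumr; apply: eq_big => [j|j]; first by rewrite E iS.
by move=> /eqP ->; rewrite inversions_set1.
Qed.

(** For [i != j] exactly one of [i < j] and [j < i] holds, so exchanging the two summation indices
    flips every sign. *)
Lemma vec_wedgeC x y :
  wedge (ext_vec x) (ext_vec y) = - wedge (ext_vec y) (ext_vec x).
Proof.
apply/ffunP => S; rewrite [RHS]ffunE !wedge_vecsE (exchange_big_dep xpredT) //= -sumrN.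
apply: eq_bigr => i _; rewrite -sumrN; apply: eq_big => [j|j /andP[ij _]].
  by rewrite eq_sym setUC.
rewrite ltnNge leq_eqVlt (inj_eq val_inj) (negbTE ij) /=.
by case: (j < i)%N; rewrite /= ?expr0 ?expr1; ring.
Qed.

Lemma vec_wedge_self x : wedge (ext_vec x) (ext_vec x) = 0.
Proof.
have := vec_wedgeC x x; move: (wedge _ _) => u /ffunP uN; apply/ffunP => S.
have /eqP := uN S; rewrite [X in _ == X -> _]ffunE -addr_eq0 -mulr2n mulrn_eq0 /=.
by rewrite [RHS]ffunE => /eqP.
Qed.

Lemma wedge1l u : wedge (ext_one R d) u = u.
Proof.
apply/ffunP => S; rewrite ffunE (bigD1 set0) ?powersetE ?sub0set //= big1 ?addr0.
  by rewrite ffunE eqxx mulr1 setD0 inversionsE big_set0 expr0 mul1r.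
by move=> A /andP[_ A0]; rewrite ffunE (negbTE A0) mulr0 mul0r.
Qed.

Lemma wedge1r u : wedge u (ext_one R d) = u.
Proof.
apply/ffunP => S; rewrite ffunE (bigD1 S) ?powersetE //=.
rewrite [X in _ + X]big1 ?addr0 => [|A].
  rewrite ffunE setDv eqxx mulr1 inversionsE big1 ?expr0 ?mul1r // => i _.
  by rewrite big_set0.
rewrite powersetE => /andP[AS AneqS]; rewrite ffunE setD_eq0.
case: (boolP (S \subset A)) => SA; last by rewrite mulr0.
by move: AneqS; rewrite eqEsubset AS SA.
Qed.

Lemma ext_vecD x y : ext_vec (x + y) = ext_vec x + ext_vec y.
Proof.
apply/ffunP => S; rewrite !ffunE -big_split; apply: eq_bigr => i _.
by rewrite mxE.
Qed.

Lemma ext_vec_sum (I : finType) (F : I -> 'cV[R]_d) :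
  ext_vec (\sum_i F i) = \sum_i ext_vec (F i).
Proof.
apply: (big_morph _ ext_vecD); apply/ffunP => S; rewrite !ffunE big1 // => i _.
by rewrite mxE.
Qed.

Lemma wedge_vecZ_eq0 u x (a : R) :
  wedge u (ext_vec x) = 0 -> wedge u (ext_vec (a *: x)) = 0.
Proof.
move=> /ffunP ux0; apply/ffunP => S; have := ux0 S.
rewrite !wedge_vecE [X in _ = X -> _]ffunE [X in _ -> _ = X]ffunE => uxS.
under eq_bigr => i _ do rewrite mxE mulrCA.
by rewrite -mulr_sumr uxS mulr0.
Qed.

Lemma ext_norm_ge u S : `|u S| <= ext_norm u.
Proof. exact: (le_bigmax_cond _ (fun T => `|u T|)). Qed.

Lemma ext_norm_ge0 u : 0 <= ext_norm u.
Proof. exact: le_trans (ext_norm_ge u set0). Qed.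

Lemma ext_norm_le u (b : R) : 0 <= b -> (forall S, `|u S| <= b) -> ext_norm u <= b.
Proof. by move=> b0 H; apply: bigmax_le. Qed.

Lemma ext_normD u v : ext_norm (u + v) <= ext_norm u + ext_norm v.
Proof.
apply: ext_norm_le => [|S]; first by rewrite addr_ge0 ?ext_norm_ge0.
by rewrite ffunE (le_trans (ler_normD _ _)) // lerD ?ext_norm_ge.
Qed.

Lemma ext_norm_vec x (b : R) : (forall i, `|x i 0| <= b) -> 0 <= b ->
  ext_norm (ext_vec x) <= d%:R * b.
Proof.
move=> xb b0; apply: ext_norm_le => [|S]; first by rewrite mulr_ge0.
rewrite ffunE (le_trans (ler_norm_sum _ _ _)) //.
rewrite [leRHS](_ : _ = \sum_(i < d) b); last first.
  by rewrite sumr_const card_ord mulr_natl.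
rewrite big_mkcond ler_sum // => i _; case: ifP => //.
Qed.

(** Each coordinate is a sum over the subsets of [S], at most [2 ^ d] in number. *)
Lemma ext_norm_wedge u v :
  ext_norm (wedge u v) <= (2 ^ d)%:R * (ext_norm u * ext_norm v).
Proof.
have uv0 : 0 <= ext_norm u * ext_norm v by rewrite mulr_ge0 ?ext_norm_ge0.
apply: ext_norm_le => [|S]; first by rewrite mulr_ge0.
rewrite ffunE (le_trans (ler_norm_sum _ _ _)) //.
apply: (@le_trans _ _ (\sum_(A in powerset S) ext_norm u * ext_norm v)).
  apply: ler_sum => A _; rewrite !normrM normrX normrN1 expr1n mul1r.
  by rewrite ler_pM ?ext_norm_ge.
rewrite sumr_const card_powerset -[leLHS]mulr_natl ler_wpM2r // ler_nat leq_pexp2l //.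
by rewrite -[X in (_ <= X)%N]card_ord max_card.
Qed.

End Wedge.

(** * Integral elements of degrees 1 and 2, and 2x2 minors *)

Section WedgeSupport.
Import mathcomp.boot.fintype mathcomp.boot.finset.
Local Open Scope set_scope.
Variables (R : realType) (d : nat).
Implicit Types (x y : 'cV[R]_d) (S : {set 'I_d}).

Lemma ext_int_vec (w : 'cV[int]_d) : ext_int 1 (ext_vec (map_mx intr w : 'cV[R]_d)).
Proof.
split=> S; last by rewrite ffunE rpred_sum // => i _; rewrite mxE intr_int.
by move=> S1; rewrite ffunE big_pred0 // => i; apply/eqP => SE; move: S1; rewrite SE cards1.
Qed.

Lemma ext_int1P (Z : ext R d) : ext_int 1 Z ->
  exists w : 'cV[int]_d, Z = ext_vec (map_mx intr w).
Proof.
move=> [Z1 Zint]; exists (\col_i Num.floor (Z [set i])); apply/ffunP => S.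
rewrite ffunE; have [/eqP/cards1P[i ->]|S1] := eqVneq #|S| 1%N.
  rewrite (big_pred1 i) => [|j /=]; last by rewrite (inj_eq set1_inj) eq_sym.
  by rewrite !mxE floorK.
rewrite Z1 // big_pred0 // => i; apply/eqP => SE; by move: S1; rewrite SE cards1.
Qed.

Lemma ext_int_wedge (w w' : 'cV[int]_d) :
  ext_int 2 (wedge (ext_vec (map_mx intr w : 'cV[R]_d)) (ext_vec (map_mx intr w'))).
Proof.
split=> S; rewrite wedge_vecsE.
  move=> S2; apply: big1 => i _; apply: big_pred0 => j; apply/negP => /andP[ij /eqP SE].
  by move: S2; rewrite SE cards2 ij.
apply: rpred_sum => i _; apply: rpred_sum => j _.
by rewrite !mxE !rpredM ?rpredX ?rpredN ?rpred1 ?intr_int.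
Qed.

(** The coordinate is a 2x2 minor up to sign; absolute values make the formula independent of the
    order of [i] and [j]. *)
Lemma wedge_vecs_set2 x y (i j : 'I_d) : i != j ->
  `|wedge (ext_vec x) (ext_vec y) [set i; j]| =
  `|x i 0 * y j 0 - x j 0 * y i 0|.
Proof.
have key k l : k != l -> (i != j) ->
    [set i; j] == [set k; l] = (((k == i) && (l == j)) || ((k == j) && (l == i))).
  move=> kl ij; apply/eqP/orP => [/setP E|].
    have := E k; have := E l; rewrite !inE !eqxx orbT /=.
    case: (eqVneq l i) => [li|_]; case: (eqVneq k i) => [ki|_] //=.
    - by move: kl; rewrite li ki eqxx.
    - by move=> _ ->; right.
    - by move=> ->; left.
    - by move=> /eqP lj /eqP kj; move: kl; rewrite kj lj eqxx.
  by case=> /andP[/eqP-> /eqP->] //; rewrite setUC.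
move=> ij; rewrite wedge_vecsE (bigD1 i) //= [X in X + _](big_pred1 j) => [|l /=]; last first.
  have [<-|il] := eqVneq i l; first by rewrite (negbTE ij).
  by rewrite key // eqxx (negbTE ij) /= orbF.
rewrite (bigD1 j) /=; last by rewrite eq_sym.
rewrite [X in _ + (X + _)](big_pred1 i) => [|l /=]; last first.
  have [<-|jl] := eqVneq j l; first by rewrite [RHS]eq_sym (negbTE ij).
  by rewrite key // eqxx (eq_sym j i) (negbTE ij).
rewrite big1 => [|k /andP[ki kj]]; last first.
  apply: big_pred0 => l; have [//|kl] := eqVneq k l.
  by rewrite key // (negbTE ki) (negbTE kj).
have -> : (i < j)%N = ~~ (j < i)%N by rewrite -leqNgt ltn_neqAle (inj_eq val_inj) ij.
rewrite addr0; case: (j < i)%N; rewrite /= ?expr0 ?expr1; last by congr `|_|; ring.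
by rewrite -normrN; congr `|_|; ring.
Qed.

Lemma wedge_vecs_eq0 x y : wedge (ext_vec x) (ext_vec y) = 0 ->
  forall i j, x i 0 * y j 0 = x j 0 * y i 0.
Proof.
move=> /ffunP xy0 i j; have [->//|ij] := eqVneq i j.
apply/eqP; rewrite -subr_eq0 -normr_eq0 -wedge_vecs_set2 //.
by rewrite xy0 ffunE normr0.
Qed.

End WedgeSupport.

(** * Primitive integer vectors *)

Section Primitive.
Variable d : nat.
Implicit Types w : 'cV[int]_d.

Definition primitive w := \big[gcdn/0%N]_i absz (w i 0) = 1%N.

Lemma primitive_factor w : w != 0 ->
  exists (c : int) w0, [/\ c != 0, w = c *: w0 & primitive w0].
Proof.
move=> w0; pose g := \big[gcdn/0%N]_i absz (w i 0).
have gw i : (g %| w i ord0)%Z by rewrite dvdzE /=; apply: biggcdn_inf.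
have g0 : g != 0%N.
  apply: contraNN w0 => /eqP g0; apply/eqP/matrixP => i j; rewrite ord1 mxE.
  by apply/eqP; have := gw i; rewrite g0 dvd0z.
pose u : 'cV[int]_d := \col_i (w i ord0 %/ g)%Z.
have wE : w = g%:Z *: u.
  by apply/matrixP => i j; rewrite ord1 !mxE mulrC divzK.
exists g, u; split=> //.
pose h := \big[gcdn/0%N]_i absz (u i 0).
(* [g * h] divides every coordinate of [w], hence their gcd [g]; this forces [h = 1]. *)
have : (g * h %| g * 1)%N.
  rewrite muln1; apply/dvdn_biggcdP => i _.
  rewrite wE mxE abszM /= dvdn_pmul2l ?lt0n //.
  exact: biggcdn_inf.
by rewrite dvdn_pmul2l ?lt0n // dvdn1 => /eqP.
Qed.

Lemma primitive_neq0 w : primitive w -> w != 0.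
Proof.
move=> wp; apply/eqP => w0; have : \big[gcdn/0%N]_i absz (w i 0) = 0%N; last by rewrite wp.
by apply/eqP; rewrite -dvd0n; apply/dvdn_biggcdP => i _; rewrite w0 mxE.
Qed.

(** By proportionality a nonzero coordinate [w i] divides every [w' i * w j], hence the gcd of these
    over [j], which is [w' i] up to sign since [w] is primitive. *)
Lemma primitive_parallel w w' : primitive w ->
  (forall i j, w i 0 * w' j 0 = w j 0 * w' i 0) ->
  exists c : int, w' = c *: w.
Proof.
move=> wp par; have [i wi0] : exists i, w i 0 != 0.
  apply/existsP; rewrite -negb_forall; apply/negP => /forallP w0.
  have /negP := primitive_neq0 _ wp; apply; apply/eqP/matrixP => i j.
  by rewrite ord1 mxE; apply/eqP.
have /dvdzP[c cE] : (w i ord0 %| w' i ord0)%Z.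
  rewrite dvdzE -[absz (w' i ord0)]muln1 -[X in (_ * X)%N]wp.
  rewrite (big_morph _ (muln_gcdr _) (muln0 _)); apply/dvdn_biggcdP => j _.
  by rewrite -abszM mulrC -par abszM dvdn_mulr.
exists c; apply/matrixP => j k; rewrite ord1 mxE; apply: (mulfI wi0).
by rewrite par cE; ring.
Qed.

End Primitive.

(** * The graph of [Theta] and wedge products with the [ell i] *)

Section LatticeVectors.
Import mathcomp.boot.fintype mathcomp.boot.finset.
Local Open Scope set_scope.
Variables (R : realType) (m n : nat) (Theta : 'M[R]_(n, m)).
Implicit Types (z : 'cV[R]_(m + n)) (i : 'I_m) (j : 'I_n) (s : seq 'I_m).

Definition height z : R := `|usubmx z|.
Definition defect z : 'cV[R]_n := dsubmx z - Theta *m usubmx z.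
Definition err z : R := `|defect z|.

Lemma height_ge0 z : 0 <= height z. Proof. exact: normr_ge0. Qed.
Lemma err_ge0 z : 0 <= err z. Proof. exact: normr_ge0. Qed.

Lemma norm_coord_le p (x : 'cV[R]_p) k : `|x k 0| <= `|x|.
Proof.
rewrite /Num.norm /= mx_normrE.
exact: (le_bigmax_cond _ (fun ij : 'I_p * 'I_1 => `|x ij.1 ij.2|) (j := (k, 0))).
Qed.

Lemma norm_col_le p (x : 'cV[R]_p) (b : R) : 0 <= b ->
  (forall k, `|x k 0| <= b) -> `|x| <= b.
Proof.
move=> b0 xb; rewrite /Num.norm /= mx_normrE; apply: bigmax_le => // -[k l] _ /=.
by rewrite ord1.
Qed.

Let ell i : 'cV[R]_(m + n) := col (lshift n i) (ell_mx Theta).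

Lemma ell_lshift i i' : ell i (lshift n i') 0 = (i' == i)%:R.
Proof. by rewrite mxE block_mxEul mxE. Qed.

Lemma ell_rshift i j : ell i (rshift m j) 0 = Theta j i.
Proof. by rewrite mxE block_mxEdl. Qed.

(** This is the point of the graph of [Theta] with the same upper block [x]. The [ell i] form a
    basis of the graph, and [defect_part] is the vertical remainder. *)
Definition graph_part z : 'cV[R]_(m + n) := col_mx (usubmx z) (Theta *m usubmx z).
Definition defect_part z : 'cV[R]_(m + n) := col_mx 0 (defect z).

Lemma graph_defect_split z : z = graph_part z + defect_part z.
Proof.
by rewrite /graph_part /defect_part add_col_mx addr0 addrCA subrr addr0 vsubmxK.
Qed.

Lemma graph_partE z : graph_part z = \sum_i z (lshift n i) 0 *: ell i.
Proof.
apply/matrixP => k l; rewrite ord1 summxE; case: (split_ordP k) => [i ->|j ->].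
  rewrite col_mxEu mxE (bigD1 i) //= big1 => [|i' i'i].
    by rewrite addr0 mxE ell_lshift eqxx mulr1.
  by rewrite mxE ell_lshift eq_sym (negbTE i'i) mulr0.
rewrite col_mxEd mxE; apply: eq_bigr => i _.
by rewrite [in RHS]mxE ell_rshift mulrC mxE.
Qed.

Lemma height_graph z : height (graph_part z) = height z.
Proof. by rewrite /height col_mxKu. Qed.

Lemma err_graph z : err (graph_part z) = 0.
Proof. by rewrite /err /defect col_mxKu col_mxKd subrr normr0. Qed.

Lemma height_defect z : height (defect_part z) = 0.
Proof. by rewrite /height col_mxKu normr0. Qed.

Lemma err_defect z : err (defect_part z) = err z.
Proof. by rewrite /err /defect col_mxKu col_mxKd mulmx0 subr0. Qed.

(** The form of [Lwedge] indexed by a sequence, suited to induction on the factors. *)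
Definition Lseq s : ext R (m + n) :=
  \big[@wedge R (m + n)/ext_one R (m + n)]_(i <- s) ext_vec (ell i).

Lemma LwedgeE sigma :
  Lwedge Theta sigma = Lseq [seq i <- index_enum 'I_m | i \in sigma].
Proof. by rewrite /Lseq big_filter. Qed.

(** Passing each factor changes the sign once; a result up to sign suffices to prove vanishing. *)
Lemma Lseq_vecC s z :
  wedge (Lseq s) (ext_vec z) = wedge (ext_vec z) (Lseq s) \/
  wedge (Lseq s) (ext_vec z) = - wedge (ext_vec z) (Lseq s).
Proof.
elim: s => [|i s IH]; rewrite /Lseq ?big_nil ?big_cons.
  by left; rewrite wedge1l wedge1r.
rewrite -/(Lseq s) wedgeA.
case: IH => ->; [right|left];
  by rewrite ?wedgeNr -wedgeA vec_wedgeC wedgeNl ?opprK wedgeA.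
Qed.

Lemma Lseq_ell s i : i \in s -> wedge (Lseq s) (ext_vec (ell i)) = 0.
Proof.
elim: s => // k s IH; rewrite inE /Lseq big_cons -/(Lseq s) wedgeA.
case/orP=> [/eqP ->|/IH ->]; last by rewrite wedge0r.
by case: (Lseq_vecC s (ell k)) => ->; rewrite ?wedgeNr -wedgeA vec_wedge_self wedge0l ?oppr0.
Qed.

Lemma imset_lshiftD1 (T : {set 'I_m}) i :
  (lshift n @: T) :\ lshift n i = lshift n @: (T :\ i).
Proof.
apply/setP => k; rewrite !inE; apply/andP/imsetP => [[ki /imsetP[l lT kl]]|[l]].
  exists l => //; rewrite !inE lT andbT; apply: contraNneq ki => <-.
  by rewrite kl.
rewrite !inE => /andP[li lT] ->; split; last exact: imset_f.
by rewrite (inj_eq (@lshift_inj _ _)).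
Qed.

(** The first [m] coordinates of the [ell i] form an identity block, so among sets of the first [m]
    indices only the set of factors itself has a nonzero coefficient, equal to 1 or -1. *)
Lemma Lseq_coef s (T : {set 'I_m}) : uniq s ->
  `|Lseq s (lshift n @: T)| = (T == [set i in s])%:R.
Proof.
elim: s T => [|k s IH] T.
  rewrite /Lseq big_nil ffunE imset_eq0 normr_nat => _.
  by congr (_ == _)%:R; apply/setP => i; rewrite !inE.
rewrite cons_uniq => /andP[ks us]; rewrite /Lseq big_cons -/(Lseq s).
rewrite vec_wedgeE big_imset /=; last by move=> ? ? _ _ /lshift_inj.
have [kT|kT] := boolP (k \in T).
  rewrite (bigD1 k) //= big1 => [|i /andP[_ ik]]; last first.
    by rewrite ell_lshift (negbTE ik) mulr0 mul0r.
  rewrite addr0 ell_lshift eqxx mulr1 normrM normrX normrN1 expr1n mul1r.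
  rewrite imset_lshiftD1 IH //; congr (_%:R); congr nat_of_bool; apply/eqP/eqP.
    by rewrite -{2}(setD1K kT) => ->; apply/setP => i; rewrite !inE.
  move=> ->; apply/setP => i; rewrite !inE.
  by have [->|] := eqVneq i k => //=; rewrite (negbTE ks).
rewrite big1 => [|i iT]; last first.
  rewrite ell_lshift (_ : i == k = false) ?mulr0 ?mul0r //.
  by apply/negbTE; apply: contraNneq kT => <-.
rewrite normr0 (_ : _ == _ = false) //; apply/negbTE; apply: contraNneq kT => ->.
by rewrite !inE eqxx.
Qed.

Lemma Lwedge_coef (sigma T : {set 'I_m}) :
  `|Lwedge Theta sigma (lshift n @: T)| = (T == sigma)%:R.
Proof. rewrite LwedgeE Lseq_coef ?filter_uniq ?index_enum_uniq //.
congr (_ == _)%:R; apply/setP => i.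
by rewrite !inE mem_filter mem_index_enum andbT. Qed.

Lemma Lwedge_ell (sigma : {set 'I_m}) i : i \in sigma ->
  wedge (Lwedge Theta sigma) (ext_vec (ell i)) = 0.
Proof. by move=> is_; rewrite LwedgeE Lseq_ell ?mem_filter ?is_ ?mem_index_enum. Qed.

(** In the coordinate at [i |: sigma] only the term removing [i] survives: removing another [k]
    leaves a set different from [sigma], where [Lwedge] has coefficient 0. *)
Lemma coord_le_wedge (sigma : {set 'I_m}) i z : i \notin sigma ->
  `|z (lshift n i) 0| <= ext_norm (wedge (Lwedge Theta sigma) (ext_vec z)).
Proof.
move=> is_; apply: le_trans (ext_norm_ge _ _ _ (lshift n @: (i |: sigma))).
rewrite wedge_vecE big_imset /=; last by move=> ? ? _ _ /lshift_inj.
rewrite (bigD1 i) ?setU11 //= big1 => [|k /andP[]]; last first.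
  rewrite !inE => /orP[->//|ks ki]; rewrite imset_lshiftD1.
  have /eqP := Lwedge_coef sigma ((i |: sigma) :\ k).
  rewrite (_ : _ == sigma = false) ?normr_eq0 => [/eqP ->|]; first by rewrite mulr0 mul0r.
  by apply/negbTE/eqP => /setP/(_ k); rewrite !inE eqxx ks.
rewrite addr0 !normrM normrX normrN1 expr1n mul1r imset_lshiftD1 setU1K //.
by rewrite Lwedge_coef eqxx mul1r.
Qed.

Lemma wedge_graph (sigma : {set 'I_m}) z : #|sigma| = m ->
  wedge (Lwedge Theta sigma) (ext_vec (graph_part z)) = 0.
Proof.
move=> sm; rewrite graph_partE ext_vec_sum wedge_sumr big1 // => i _.
apply: wedge_vecZ_eq0; apply: Lwedge_ell.
suff -> : sigma = setT by rewrite inE.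
by apply/eqP; rewrite eqEcard subsetT cardsT card_ord sm leqnn.
Qed.

(** A full [sigma] kills the graph part, and the defect part vanishes on the first [m] indices. The
    coordinate at these indices together with [rshift m j] is then [defect z j] up to sign. *)
Lemma defect_le_wedge (sigma : {set 'I_m}) j z : #|sigma| = m ->
  `|defect z j 0| <= ext_norm (wedge (Lwedge Theta sigma) (ext_vec z)).
Proof.
move=> sm; rewrite [X in ext_vec X]graph_defect_split ext_vecD wedgeDr wedge_graph // add0r.
have jT : rshift m j \notin lshift n @: sigma.
  by apply/imsetP => -[i _ /eqP]; rewrite eq_sym eq_lrshift.
apply: le_trans (ext_norm_ge _ _ _ (rshift m j |: lshift n @: sigma)).
rewrite wedge_vecE (bigD1 (rshift m j)) ?setU11 //= big1 => [|k /andP[]]; last first.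
  rewrite !inE => /orP[->//|/imsetP[i _ ->] _].
  by rewrite col_mxEu mxE mulr0.
rewrite addr0 setU1K // !normrM normrX normrN1 expr1n mul1r Lwedge_coef eqxx.
by rewrite mul1r col_mxEd.
Qed.

(** At most one index is missing from [sigma], so two factors [ell i] and [ell k] either repeat a
    factor of [sigma] or coincide. *)
Lemma wedge_graph2 (sigma : {set 'I_m}) z z' : (m <= #|sigma|.+1)%N ->
  wedge (Lwedge Theta sigma)
    (wedge (ext_vec (graph_part z)) (ext_vec (graph_part z'))) = 0.
Proof.
move=> sm.
have ell2 i k : wedge (Lwedge Theta sigma) (wedge (ext_vec (ell i)) (ext_vec (ell k))) = 0.
  have [is_|is_] := boolP (i \in sigma); first by rewrite -wedgeA Lwedge_ell // wedge0l.
  have [ks|ks] := boolP (k \in sigma).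
    by rewrite vec_wedgeC wedgeNr -wedgeA Lwedge_ell // wedge0l oppr0.
  suff -> : i = k by rewrite vec_wedge_self wedge0r.
  apply/eqP/negPn/negP => ik.
  have := subset_leq_card (subsetT (i |: (k |: sigma))).
  rewrite cardsT card_ord !cardsU1 !inE negb_or ik is_ ks /= !add1n => sm2.
  by have := leq_trans sm2 sm; rewrite ltnn.
rewrite (graph_partE z') ext_vec_sum 2!wedge_sumr big1 // => k _.
rewrite -wedgeA; apply: wedge_vecZ_eq0; rewrite wedgeA vec_wedgeC wedgeNr.
rewrite graph_partE ext_vec_sum 2!wedge_sumr big1 ?oppr0 // => i _.
by rewrite -wedgeA; apply: wedge_vecZ_eq0; rewrite wedgeA.
Qed.

(** The lower block of [z] is its defect plus [Theta] applied to the upper block, so each coordinate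
    is controlled by height and error. *)
Lemma ext_norm_lattice : exists2 C : R, 1 <= C &
  forall z, ext_norm (ext_vec z) <= C * (height z + err z).
Proof.
pose A := 1 + m%:R * `|Theta|.
have A1 : 1 <= A by rewrite lerDl mulr_ge0.
exists ((m + n)%:R * A + 1) => [|z]; first by rewrite lerDr mulr_ge0 // (le_trans _ A1).
have h0 := height_ge0 z; have e0 := err_ge0 z.
have he : 0 <= A * (height z + err z) by rewrite mulr_ge0 ?addr_ge0 // (le_trans _ A1).
apply: (@le_trans _ _ ((m + n)%:R * (A * (height z + err z)))); last first.
  by rewrite mulrA ler_wpM2r ?addr_ge0 // lerDl.
apply: ext_norm_vec => // k.
case: (split_ordP k) => [i ->|j ->].
  apply: (@le_trans _ _ (height z)).
    by have := norm_coord_le _ (usubmx z) i; rewrite mxE.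
  rewrite mulrDr -[leLHS]addr0 lerD ?mulr_ge0 ?(le_trans _ A1) //.
  by rewrite ler_peMl.
have -> : z (rshift m j) 0 = defect z j 0 + \sum_i Theta j i * z (lshift n i) 0.
  rewrite !mxE [X in _ - X + _](eq_bigr (fun i => Theta j i * z (lshift n i) 0)).
    by rewrite subrK.
  by move=> i _; rewrite mxE.
apply: le_trans (ler_normD _ _) _.
have S1 : `|\sum_i Theta j i * z (lshift n i) 0| <= m%:R * `|Theta| * height z.
  apply: le_trans (ler_norm_sum _ _ _) _.
  rewrite -mulrA [leRHS](_ : _ = \sum_(i < m) `|Theta| * height z); last first.
    by rewrite sumr_const card_ord mulr_natl.
  apply: ler_sum => i _; rewrite normrM ler_pM //.
    rewrite {2}/Num.norm /= mx_normrE.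
    exact: (le_bigmax_cond _ (fun ij : 'I_n * 'I_m => `|Theta ij.1 ij.2|) (j := (j, i))).
  by have := norm_coord_le _ (usubmx z) i; rewrite mxE.
have := norm_coord_le _ (defect z) j; rewrite -/(err z) => S2.
have : 0 <= m%:R * `|Theta| * err z by rewrite !mulr_ge0.
by rewrite /A; nra.
Qed.

Lemma wedge1_bound : exists2 C : R, 1 <= C & forall (sigma : {set 'I_m}) z,
  ext_norm (wedge (Lwedge Theta sigma) (ext_vec z)) <=
    C * (if #|sigma| == m then err z else height z + err z).
Proof.
have [C C1 CP] := ext_norm_lattice.
pose M := \big[Order.max/0]_(sigma : {set 'I_m}) ext_norm (Lwedge Theta sigma).
have M0 : 0 <= M by exact: bigmax_ge_id.
pose D : R := (2 ^ (m + n))%:R.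
have D0 : 0 <= D by [].
have DMC : 0 <= D * (M * C) by rewrite !mulr_ge0 // (le_trans _ C1).
have bnd sigma z : ext_norm (wedge (Lwedge Theta sigma) (ext_vec z)) <=
    (D * (M * C) + 1) * (height z + err z).
  apply: le_trans (ext_norm_wedge _ _ _ _) _.
  apply: (@le_trans _ _ (D * (M * C) * (height z + err z))); last first.
    by rewrite ler_wpM2r ?addr_ge0 ?height_ge0 ?err_ge0 // lerDl.
  rewrite -!mulrA ler_wpM2l // ler_pM ?ext_norm_ge0 //.
  exact: (le_bigmax_cond _ (fun T => ext_norm (Lwedge Theta T))).
exists (D * (M * C) + 1) => [|sigma z]; first by rewrite lerDr.
case: eqP => // sm; rewrite [X in ext_vec X]graph_defect_split ext_vecD wedgeDr.
rewrite wedge_graph // add0r; apply: le_trans (bnd _ _) _.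
by rewrite height_defect err_defect add0r.
Qed.

(** Both vectors are split into graph and defect parts: two graph factors vanish when at most one
    index is missing from [sigma], a single one when none is. The crude bound [bnd] is then applied
    to the surviving terms, where graph parts have error 0 and defect parts have height 0. *)
Lemma wedge2_bound : exists2 C : R, 1 <= C & forall (sigma : {set 'I_m}) z z',
  ext_norm (wedge (Lwedge Theta sigma) (wedge (ext_vec z) (ext_vec z'))) <=
    C * (if (#|sigma| == m) then err z * err z'
         else if (#|sigma|.+1 == m) then
           height z * err z' + err z * height z' + err z * err z'
         else (height z + err z) * (height z' + err z')).
Proof.
have [C C1 CP] := ext_norm_lattice.
pose M := \big[Order.max/0]_(sigma : {set 'I_m}) ext_norm (Lwedge Theta sigma).
have M0 : 0 <= M by exact: bigmax_ge_id.
pose D : R := (2 ^ (m + n))%:R.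
have D0 : 0 <= D by [].
have C0 : 0 <= C by rewrite (le_trans _ C1).
pose K := D * (M * (D * (C * C))).
have K0 : 0 <= K by rewrite !mulr_ge0.
have bnd sigma z z' :
    ext_norm (wedge (Lwedge Theta sigma) (wedge (ext_vec z) (ext_vec z'))) <=
    (K + 1) * ((height z + err z) * (height z' + err z')).
  have hz := height_ge0 z; have ez := err_ge0 z.
  have hz' := height_ge0 z'; have ez' := err_ge0 z'.
  apply: (@le_trans _ _ (K * ((height z + err z) * (height z' + err z')))); last first.
    by rewrite ler_wpM2r ?mulr_ge0 ?addr_ge0 // lerDl.
  apply: le_trans (ext_norm_wedge _ _ _ _) _.
  rewrite /K -!mulrA ler_wpM2l // ler_pM ?ext_norm_ge0 //.
    exact: (le_bigmax_cond _ (fun T => ext_norm (Lwedge Theta T))).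
  apply: le_trans (ext_norm_wedge _ _ _ _) _.
  rewrite ler_wpM2l //.
  rewrite (_ : C * _ = (C * (height z + err z)) * (C * (height z' + err z'))); last by ring.
  by rewrite ler_pM ?ext_norm_ge0.
exists (K + 1) => [|sigma z z']; first by rewrite lerDr.
pose g := graph_part; pose r := defect_part.
have split2 : wedge (ext_vec z) (ext_vec z') =
    wedge (ext_vec (g z)) (ext_vec (g z')) + wedge (ext_vec (g z)) (ext_vec (r z')) +
    (wedge (ext_vec (r z)) (ext_vec (g z')) + wedge (ext_vec (r z)) (ext_vec (r z'))).
  rewrite -!wedgeDr -!ext_vecD -graph_defect_split -wedgeDl -ext_vecD.
  by rewrite -graph_defect_split.
have rr : ext_norm (wedge (Lwedge Theta sigma) (wedge (ext_vec (r z)) (ext_vec (r z')))) <=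
    (K + 1) * (err z * err z').
  by apply: le_trans (bnd _ _ _) _; rewrite !height_defect !err_defect !add0r.
case: eqP => sm.
  rewrite split2 !wedgeDr -!wedgeA !wedge_graph // !wedge0l !wedgeA.
  by rewrite vec_wedgeC wedgeNr -wedgeA wedge_graph // wedge0l oppr0 !add0r.
case: eqP => // sm1.
rewrite split2 !wedgeDr wedge_graph2 ?sm1 // add0r.
apply: le_trans (ext_normD _ _ _ _) _; apply: le_trans (lerD (lexx _) (ext_normD _ _ _ _)) _.
rewrite 2!mulrDr -addrA; apply: lerD; last apply: lerD => //.
  apply: le_trans (bnd _ _ _) _.
  by rewrite height_graph err_graph height_defect err_defect addr0 add0r.
apply: le_trans (bnd _ _ _) _.
by rewrite height_graph err_graph height_defect err_defect addr0 add0r.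
Qed.

End LatticeVectors.

(** * Growth of real powers *)

Section PowerAux.
Variable R : realType.

Lemma powR_eventually_ge (c e : R) : 0 < e ->
  exists2 T0 : R, 1 <= T0 & forall T, T0 <= T -> c <= T `^ e.
Proof.
move=> e0; exists (Num.max 1 (Num.max 1 c `^ e^-1)); first by rewrite le_max lexx.
move=> T; rewrite ge_max => /andP[T1 cT].
apply: (@le_trans _ _ (Num.max 1 c)); first by rewrite le_max lexx orbT.
have m0 : 0 <= Num.max 1 c by rewrite le_max ler01.
have -> : Num.max 1 c = (Num.max 1 c `^ e^-1) `^ e.
  by rewrite -powRrM mulVf ?powRr1 // lt0r_neq0.
by apply: ge0_ler_powR; rewrite ?nnegrE ?powR_ge0 ?(ltW e0) // (le_trans _ T1).
Qed.

End PowerAux.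

(** * Exponents in terms of integer points, and Dirichlet's theorem *)

Section Exponents.
Import mathcomp.boot.fintype mathcomp.boot.finset.
Variables (R : realType) (m n : nat) (Theta : 'M[R]_(n, m)).
Implicit Types (w : 'cV[int]_(m + n)) (sigma : {set 'I_m}).

Definition emb w : 'cV[R]_(m + n) := map_mx intr w.

Lemma emb_eq0 w : (ext_vec (emb w) == 0) = (w == 0).
Proof.
apply/eqP/eqP => [/ffunP w0|->]; last first.
  by apply/ffunP => S; rewrite !ffunE big1 // => i _; rewrite !mxE.
apply/matrixP => i j; rewrite ord1 mxE; apply/eqP; rewrite -(intr_eq0 R).
have := w0 [set i]%SET; rewrite !ffunE (big_pred1 i) => [|k /=].
  by rewrite !mxE => ->.
by rewrite (inj_eq set1_inj) eq_sym.
Qed.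

(** For [p = 1] one has [k0 = m - 1], so sizes [m - 1] and [m] have right sides [t] and [t ^ (- g)].
    The complement of [i] detects the coordinate [i] of the upper block, the full set detects the
    defect. *)
Lemma solvable_at1 (g t : R) : (0 < m)%N -> 0 <= t -> solvable_at Theta 1 g t ->
  exists w, [/\ w != 0, height R m n (emb w) <= t & err R m n Theta (emb w) <= t `^ (- g)].
Proof.
move=> m0 t0 [Z [/ext_int1P[w ->]]]; rewrite -/(emb w) emb_eq0 => w0 Zle.
exists w; split=> //.
  apply: norm_col_le => // i; rewrite mxE.
  have cs : #|[set~ i]%SET| = m.-1 by rewrite cardsC1 card_ord.
  have is_ : i \notin [set~ i]%SET by rewrite !inE eqxx.
  apply: le_trans (coord_le_wedge _ _ _ Theta _ _ _ is_) _.
  apply: (@le_trans _ _ (t `^ (1 - (m.-1%:R - (k0 m 1)%:R) * (1 + g)))).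
    apply: le_trans (Zle _ (leq_pred m)).
    apply: (le_bigmax_cond _ (fun s => ext_norm (wedge (Lwedge Theta s) (ext_vec (emb w))))).
    by rewrite cs.
  by rewrite /k0 subn1 subrr mul0r subr0 powRr1.
apply: norm_col_le => [|j]; first exact: powR_ge0.
have cs : #|[set: 'I_m]%SET| = m by rewrite cardsT card_ord.
apply: le_trans (defect_le_wedge _ _ _ Theta _ j _ cs) _.
apply: (@le_trans _ _ (t `^ (1 - (m%:R - (k0 m 1)%:R) * (1 + g)))).
  apply: le_trans (Zle _ (leqnn m)).
  apply: (le_bigmax_cond _ (fun s => ext_norm (wedge (Lwedge Theta s) (ext_vec (emb w))))).
  by rewrite cs.
rewrite /k0 (_ : 1 - _ = - g) //.
by rewrite -natrB ?leq_subr // subKn // mul1r opprD addrA subrr add0r.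
Qed.

(** Replacing [T] by [K * T] and lowering [g] to [g'] absorbs the constant [K]. Truncated
    subtraction in the hypothesis gives the bound [K * T] for sizes below [k0], where the required
    exponent is at least 1. *)
Lemma solvable_at_scale (p : nat) (g g' T K : R) (Z : ext R (m + n)) :
  ext_int p Z -> Z != 0 -> - 1 < g' -> g' <= g -> 1 <= K -> 1 <= T ->
  K `^ (1 + g') <= T `^ (g - g') ->
  (forall sigma, ext_norm (wedge (Lwedge Theta sigma) Z) <=
    K * T `^ (1 - (#|sigma| - k0 m p)%N%:R * (1 + g))) ->
  solvable_at Theta p g' (K * T).
Proof.
move=> Zp Z0 g'1 g'g K1 T1 KT ZB; exists Z; split=> // k km.
have K0 : 0 < K by rewrite (lt_le_trans _ K1).
have T0 : 0 < T by rewrite (lt_le_trans _ T1).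
apply: bigmax_le => [|sigma /eqP sk]; first exact: powR_ge0.
apply: le_trans (ZB sigma) _; rewrite sk.
have [kk|kk] := leqP (k0 m p) k; last first.
  have -> : (k - k0 m p = 0)%N by apply/eqP; rewrite subn_eq0 ltnW.
  rewrite mul0r subr0 powRr1 ?(ltW T0) // -[leLHS]powRr1 ?mulr_ge0 ?(ltW K0) ?(ltW T0) //.
  apply: ler_powR; first by rewrite -[1]mulr1 ler_pM.
  rewrite lerBrDl gerDr mulr_le0_ge0 ?subr_le0 ?ler_nat ?(ltnW kk) //.
  by rewrite -lerBlDl sub0r ltW.
rewrite natrB // powRM ?(ltW K0) ?(ltW T0) //; set j := k%:R - _.
have j0 : 0 <= j by rewrite subr_ge0 ler_nat.
(* These two factorizations reduce the claim to the [j]-th power of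
   [K ^ (1 + g') <= T ^ (g - g')]. *)
have HT : T `^ (1 - j * (1 + g')) = T `^ (1 - j * (1 + g)) * (T `^ (g - g')) `^ j.
  rewrite -powRrM -powRD; last by rewrite (lt0r_neq0 T0) implybT.
  by congr (_ `^ _); ring.
have HK : K = K `^ (1 - j * (1 + g')) * (K `^ (1 + g')) `^ j.
  rewrite -powRrM -powRD; last by rewrite (lt0r_neq0 K0) implybT.
  by rewrite mulrC subrK powRr1 ?(ltW K0).
have mono (x y v z : R) : 0 <= x -> 0 <= y -> v <= z -> x * v * y <= x * (y * z).
  by move=> x0 y0 vz; rewrite -mulrA ler_wpM2l // mulrC ler_wpM2l.
rewrite HT {1}HK; apply: mono; [exact: powR_ge0|exact: powR_ge0|].
by apply: ge0_ler_powR; rewrite ?nnegrE ?powR_ge0.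
Qed.

Lemma regular_exponent_ge (p : nat) (g K : R) : - 1 < g -> 1 <= K ->
  (forall M : R, exists T Z, [/\ M <= T, 1 <= T, ext_int p Z, Z != 0 &
    forall sigma, ext_norm (wedge (Lwedge Theta sigma) Z) <=
      K * T `^ (1 - (#|sigma| - k0 m p)%N%:R * (1 + g))]) ->
  (g%:E <= regular_exponent Theta p)%E.
Proof.
move=> g1 K1 H; apply/lee_addgt0Pr => e e0.
(* This [g'] is within [e] of [g] and stays above -1, as absorbing [K] demands. *)
pose g' := g - Num.min e ((g + 1) / 2).
have g'g : g' < g by rewrite ltrBlDr ltrDl lt_min e0 divr_gt0 // -(opprK 1) subr_gt0.
have g'1 : - 1 < g'.
  have : Num.min e ((g + 1) / 2) <= (g + 1) / 2 by rewrite ge_min lexx orbT.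
  by rewrite /g'; lra.
have ge : g <= g' + e by rewrite -lerBlDl /g' opprB addrC subrK ge_min lexx.
apply: (@le_trans _ _ (g' + e)%:E); first by rewrite lee_fin.
rewrite EFinD leeD2r //; apply: ereal_sup_ubound; exists g' => //= M.
have [T0 T01 T0P] := powR_eventually_ge _ (K `^ (1 + g')) (g - g') ltac:(by rewrite subr_gt0).
have [T [Z [MT T1 Zp Z0 ZB]]] := H (Num.max T0 (`|M| + 1)).
move: MT; rewrite ge_max => /andP[T0T MT].
exists (K * T).
  apply: (@lt_le_trans _ _ T); last by rewrite ler_peMl // (le_trans _ T1).
  by apply: lt_le_trans MT; rewrite ltr_pwDr // ler_norm.
by apply: (@solvable_at_scale _ g _ _ _ Z) => //; [exact: ltW|exact: T0P].
Qed.

Lemma uniform_exponent_ge (p : nat) (g g' K : R) : - 1 < g' -> g' < g -> 1 <= K ->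
  (forall T : R, 1 <= T -> exists Z, [/\ ext_int p Z, Z != 0 &
    forall sigma, ext_norm (wedge (Lwedge Theta sigma) Z) <=
      K * T `^ (1 - (#|sigma| - k0 m p)%N%:R * (1 + g))]) ->
  (g'%:E <= uniform_exponent Theta p)%E.
Proof.
move=> g'1 g'g K1 H; apply: ereal_sup_ubound; exists g' => //=.
have K0 : 0 < K by rewrite (lt_le_trans _ K1).
have [T0 T01 T0P] := powR_eventually_ge _ (K `^ (1 + g')) (g - g') ltac:(by rewrite subr_gt0).
exists (K * T0); split; first exact: num_real.
move=> t /ltW Kt; have T0t : T0 <= t / K by rewrite ler_pdivlMr // mulrC.
have -> : t = K * (t / K) by rewrite mulrC divfK // lt0r_neq0.
have T1 : 1 <= t / K by exact: le_trans T0t.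
have [Z [Zp Z0 ZB]] := H _ T1.
by apply: (@solvable_at_scale _ g _ _ _ Z) => //; [exact: ltW|exact: T0P].
Qed.

Lemma uniform_exponent_approx (p : nat) (a : R) : (a%:E < uniform_exponent Theta p)%E ->
  exists2 g, a < g & exists M, forall t, M < t -> solvable_at Theta p g t.
Proof.
move=> /ereal_sup_gt[_ [g /= gP <-]]; rewrite lte_fin => ag; exists g => //.
by move: gP => [M [_ MP]]; exists M.
Qed.

Lemma uniform_exponent1 (a : R) : (0 < m)%N -> (a%:E < uniform_exponent Theta 1)%E ->
  exists2 M : R, 1 <= M & forall t, M <= t -> exists w,
    [/\ w != 0, height R m n (emb w) <= t & err R m n Theta (emb w) <= t `^ (- a)].
Proof.
move=> m0 /uniform_exponent_approx[g ag [M MP]].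
exists (`|M| + 1) => [|t Mt]; first by rewrite lerDr.
have t1 : 1 <= t by rewrite (le_trans _ Mt) // lerDr.
have [|//|w [w0 wt ew]] := solvable_at1 g t m0 _ (MP t _).
- exact: le_trans t1.
- by apply: lt_le_trans Mt; rewrite ltr_pwDr // ler_norm.
exists w; split=> //; apply: le_trans ew _.
by apply: ler_powR => //; rewrite lerN2 ltW.
Qed.

Lemma regular_exponent1 (b : R) : (0 < m)%N -> (b%:E < regular_exponent Theta 1)%E ->
  forall M : R, exists2 t, Num.max 1 M <= t & exists w,
    [/\ w != 0, height R m n (emb w) <= t & err R m n Theta (emb w) <= t `^ (- b)].
Proof.
move=> m0 /ereal_sup_gt[_ [g /= gP <-]]; rewrite lte_fin => bg M.
have [t Mt st] := gP (Num.max 1 M); exists t; first exact: ltW.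
have t1 : 1 <= t by move: Mt; rewrite gt_max => /andP[/ltW].
have [|w [w0 wt ew]] := solvable_at1 g t m0 _ st; first exact: le_trans t1.
exists w; split=> //; apply: le_trans ew _.
by apply: ler_powR => //; rewrite lerN2 ltW.
Qed.

Lemma uniform_le_regular (p : nat) :
  (uniform_exponent Theta p <= regular_exponent Theta p)%E.
Proof.
apply: le_ereal_sup => _ [g /= [M [_ MP]] <-]; exists g => //= T.
exists (Num.max T M + 1); first by rewrite ltr_pwDr // le_max lexx.
by apply: MP; rewrite ltr_pwDr // le_max lexx orbT.
Qed.

(** Pigeonhole on the fractional parts of the multiples of one column of [Theta]: two multiples in
    the same box differ by a good approximation. *)
Lemma dirichlet (i0 : 'I_m) (N : nat) : (0 < N)%N ->
  exists w, [/\ w != 0, height R m n (emb w) <= (N ^ n)%:R &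
    err R m n Theta (emb w) <= N%:R^-1].
Proof.
case: N => // N _.
pose u (q : nat) j := q%:R * Theta j i0.
pose fr (x : R) := x - (Num.floor x)%:~R.
have fr0 x : 0 <= fr x by rewrite subr_ge0 floor_le_tmp.
have fr1 x : fr x < 1 by rewrite ltrBlDl -intrD1 floorD1_gt.
(* After the case split the bound is [N.+1]: there are [N.+1 ^ n + 1] multiples and [N.+1 ^ n] boxes
   of side [1 / N.+1]. Fractional parts are below 1, so [inord] never takes its default value. *)
pose f (q : 'I_(N.+1 ^ n).+1) : {ffun 'I_n -> 'I_N.+1} :=
  [ffun j => inord (Num.truncn (N.+1%:R * fr (u q j)))].
have [q1 [q2 [q12 fq]]] : exists q1 q2, q1 != q2 /\ f q1 = f q2.
  have /injectivePn[q1 [q2 q12 fq]] : ~~ injectiveb f.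
    apply/negP => /injectiveP /leq_card.
    by rewrite card_ord card_ffun !card_ord ltnn.
  by exists q1, q2.
pose x : 'cV[int]_m := (q1%:Z - q2%:Z) *: delta_mx i0 0.
pose y : 'cV[int]_n := \col_j (Num.floor (u q1 j) - Num.floor (u q2 j)).
exists (col_mx x y); split.
- apply/eqP => /(congr1 usubmx)/matrixP/(_ i0 0).
  rewrite col_mxKu !mxE !eqxx mulr1 => /eqP; rewrite subr_eq0 => /eqP [] /val_inj E.
  by move: q12; rewrite E eqxx.
- rewrite /height /emb map_col_mx col_mxKu; apply: norm_col_le => // i.
  rewrite !mxE eqxx andbT; case: eqP => _; last by rewrite mulr0 normr0.
  have := ltn_ord q1; have := ltn_ord q2; rewrite !ltnS -!(ler_nat R) mulr1 => q2N q1N.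
  have dist (a b M : R) : 0 <= a -> 0 <= b -> a <= M -> b <= M -> `|a - b| <= M.
    by move=> *; rewrite ler_norml; apply/andP; split; lra.
  by rewrite rmorphB /= -!pmulrn; apply: dist.
rewrite /err; apply: norm_col_le => [|j]; first by rewrite invr_ge0.
rewrite /defect /emb map_col_mx col_mxKu col_mxKd map_mxZ map_delta_mx -scalemxAr -colE.
rewrite !mxE !rmorphB /=.
have -> : (Num.floor (u q1 j))%:~R - (Num.floor (u q2 j))%:~R - (q1%:~R - q2%:~R) * Theta j i0
    = fr (u q2 j) - fr (u q1 j) by rewrite /fr /u -!pmulrn; ring.
have N0 : 0 < N.+1%:R :> R by [].
have tr q : (Num.truncn (N.+1%:R * fr (u q j)) < N.+1)%N.
  by rewrite truncn_lt_nat ?mulr_ge0 // gtr_pMr.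
have /(congr1 (fun h : {ffun 'I_n -> 'I_N.+1} => h j : nat)) := fq.
rewrite !ffunE !inordK ?tr // => E.
have /andP[l1 r1] := truncn_itv (mulr_ge0 (ltW N0) (fr0 (u q1 j))).
have /andP[l2 r2] := truncn_itv (mulr_ge0 (ltW N0) (fr0 (u q2 j))).
rewrite -(ler_pM2l N0) divff ?lt0r_neq0 // -[X in X * _](gtr0_norm N0) -normrM mulrBr.
have dist (a b : R) (k : nat) :
    k%:R <= a -> a < k.+1%:R -> k%:R <= b -> b < k.+1%:R -> `|a - b| <= 1.
  by rewrite -natr1 => *; rewrite ler_norml; apply/andP; split; lra.
by rewrite E in l1 r1; exact: (dist _ _ _ l2 r2 l1 r1).
Qed.

(** Dirichlet's theorem gives the exponent [1 / n] up to a constant; passing to half of it leaves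
    room to absorb the constant. *)
Lemma uniform_exponent_gt0 : (0 < m)%N -> (0 < n)%N -> (0 < uniform_exponent Theta 1)%E.
Proof.
move=> m0 n0; have [C C1 CP] := wedge1_bound _ _ _ Theta.
have C0 : 0 <= C by rewrite (le_trans _ C1).
have nR : 0 < n%:R :> R by rewrite ltr0n.
have ni : 0 < n%:R^-1 :> R by rewrite invr_gt0.
apply: (@lt_le_trans _ _ (n%:R^-1 / 2)%:E); first by rewrite lte_fin divr_gt0.
apply: (@uniform_exponent_ge _ (n%:R^-1) _ (2 * C)).
- by rewrite (lt_trans _ (divr_gt0 ni _)) // ltrN10.
- by rewrite ltr_pdivrMr // ltr_pMr // ltr1n.
- by rewrite (le_trans C1) // ler_peMl // ler1n.
move=> T T1; have T0 : 0 <= T by rewrite (le_trans _ T1).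
pose s := T `^ n%:R^-1.
have s1 : 1 <= s.
  rewrite [leLHS](_ : _ = 1 `^ n%:R^-1); last by rewrite powR1.
  by rewrite ge0_ler_powR ?nnegrE // ltW.
have s0 : 0 <= s by exact: powR_ge0.
(* [N] is the integer part of [s = T ^ (1 / n)]: then [N ^ n <= T], and [s < N + 1 <= 2 * N] gives
   [1 / N <= 2 / s]. *)
have /andP[Ns sN] := truncn_itv s0; set N := Num.truncn s in Ns sN.
have N1 : (0 < N)%N.
  by rewrite lt0n; apply: contraTneq sN => ->; rewrite -leNgt.
have [w [w0 hw ew]] := dirichlet (Ordinal m0) N N1.
have NR : 0 < N%:R :> R by rewrite ltr0n.
have hT : height R m n (emb w) <= T.
  apply: le_trans hw _; rewrite natrX (_ : T = s ^+ n); first by rewrite lerXn2r ?nnegrE.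
  by rewrite -powR_mulrn // -powRrM mulVf ?lt0r_neq0 // powRr1.
have eT : err R m n Theta (emb w) <= 2 * T `^ (- n%:R^-1).
  apply: le_trans ew _; rewrite powRN -/s -[leLHS]mul1r ler_pdivrMr // mulrAC.
  rewrite ler_pdivlMr ?(lt_le_trans _ s1) // mul1r.
  apply: le_trans (ltW sN) _; rewrite -natr1 mulr2n mulrDl mul1r lerD2l.
  by rewrite ler1n.
exists (ext_vec (emb w)); split; [exact: ext_int_vec|by rewrite emb_eq0|].
move=> sigma; apply: le_trans (CP sigma _) _.
rewrite [2 * C]mulrC -mulrA ler_wpM2l //.
have sm : (#|sigma| <= m)%N by rewrite -[X in (_ <= X)%N]card_ord max_card.
case: eqP => [->|/eqP sm'].
  by rewrite /k0 subKn // mul1r opprD addrA subrr add0r.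
have -> : (#|sigma| - k0 m 1 = 0)%N.
  by apply/eqP; rewrite subn_eq0 /k0 subn1 -ltnS prednK // ltn_neqAle sm' sm.
rewrite mul0r subr0 powRr1 // mulr2n mulrDl mul1r lerD //.
apply: le_trans ew _; apply: le_trans T1.
by rewrite invf_le1 // ler1n.
Qed.

End Exponents.

(** * Pairs of independent integer points *)

Section Constructions.
Import mathcomp.boot.fintype mathcomp.boot.finset.
Variables (R : realType) (m n : nat) (Theta : 'M[R]_(n, m)).
Hypothesis m_gt0 : (0 < m)%N.
Implicit Types (w : 'cV[int]_(m + n)) (sigma : {set 'I_m}).

Let h w := height R m n (emb R m n w).
Let e w := err R m n Theta (emb R m n w).
Let em w := ext_vec (emb R m n w).

Let h_ge0 w : 0 <= h w. Proof. exact: height_ge0. Qed.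
Let e_ge0 w : 0 <= e w. Proof. exact: err_ge0. Qed.

Lemma height_emb_scale (c : int) w :
  height R m n (emb R m n (c *: w)) = `|c%:~R| * height R m n (emb R m n w).
Proof. by rewrite /height /emb map_mxZ linearZ normrZ. Qed.

Lemma err_emb_scale (c : int) w :
  err R m n Theta (emb R m n (c *: w)) = `|c%:~R| * err R m n Theta (emb R m n w).
Proof.
by rewrite /err /defect /emb map_mxZ !linearZ /= -scalerDr normrZ.
Qed.

Lemma intr_norm_ge1 (c : int) : c != 0 -> 1 <= `|c%:~R : R|.
Proof. by move=> c0; rewrite -intr_norm ler1z -gtz0_ge1 normr_gt0. Qed.

Lemma primitive_wedge_eq0 w w' : primitive _ w -> w' != 0 -> wedge (em w) (em w') = 0 ->
  exists2 c : int, c != 0 & w' = c *: w.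
Proof.
move=> wp w'0 /wedge_vecs_eq0 par.
have [|c cE] := primitive_parallel _ w w' wp.
  by move=> i j; apply: (@intr_inj R); rewrite !rmorphM /=; have := par i j; rewrite !mxE.
by exists c => //; apply: contraNneq w'0 => c0; rewrite cE c0 scale0r.
Qed.

(** The three estimates serve the sizes [m], [m - 1] and at most [m - 2] of [sigma]; the last occurs
    only for [m >= 2], hence the guard. *)
Lemma regular_exponent2_ge (g K : R) : - 1 < g -> 0 <= K ->
  (forall M : R, exists T w w', [/\ M <= T, 1 <= T, wedge (em w) (em w') != 0 &
    [/\ e w * e w' <= K * T `^ (1 - (m - k0 m 2)%N%:R * (1 + g)),
        h w * e w' + e w * h w' + e w * e w' <=
          K * T `^ (1 - (m.-1 - k0 m 2)%N%:R * (1 + g)) &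
        (2 <= m)%N -> (h w + e w) * (h w' + e w') <= K * T]]) ->
  (g%:E <= regular_exponent Theta 2)%E.
Proof.
move=> g1 K0 H; have [C C1 CP] := wedge2_bound _ _ _ Theta.
have C0 : 0 <= C by rewrite (le_trans _ C1).
apply: (@regular_exponent_ge _ _ _ _ _ _ (C * K + 1)) => // [|M].
  by rewrite lerDr mulr_ge0.
have [T [w [w' [MT T1 ww0 [B2 B1 B0]]]]] := H M.
exists T, (wedge (em w) (em w')); split=> // [|sigma]; first exact: ext_int_wedge.
apply: le_trans (CP sigma _ _) _; rewrite -/(e w) -/(e w') -/(h w) -/(h w').
apply: (@le_trans _ _ (C * K * T `^ (1 - (#|sigma| - k0 m 2)%N%:R * (1 + g)))); last first.
  by rewrite ler_wpM2r ?powR_ge0 // lerDl.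
rewrite -mulrA ler_wpM2l //.
case: eqP => [->//|sm]; case: eqP => [sm1|sm1].
  by rewrite (_ : #|sigma| = m.-1) //; move: sm1; clear; lia.
have sm2 : (#|sigma| <= m - 2)%N.
  have : (#|sigma| <= m)%N by rewrite -[X in (_ <= X)%N]card_ord max_card.
  by move: sm sm1; clear; lia.
have m2 : (2 <= m)%N.
  have : (#|sigma| <= m)%N by rewrite -[X in (_ <= X)%N]card_ord max_card.
  by move: sm sm1 m_gt0; clear; lia.
rewrite (_ : (#|sigma| - _ = 0)%N); last by apply/eqP; rewrite subn_eq0.
by rewrite mul0r subr0 powRr1 ?(le_trans _ T1) // B0.
Qed.

(** With both errors 0 the first two estimates are trivial, and the constant [h w * h w'] settles
    the third for every exponent at once. *)
Lemma regular_exponent2_pinfty w w' : wedge (em w) (em w') != 0 ->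
  e w = 0 -> e w' = 0 -> regular_exponent Theta 2 = +oo%E.
Proof.
move=> ww0 ew ew'; apply/eqyP => A A0.
apply: (@regular_exponent2_ge _ (h w * h w')) => [||M].
- by rewrite (lt_trans _ A0) // ltrN10.
- by rewrite mulr_ge0.
exists (Num.max 1 M), w, w'; rewrite !le_max !lexx orbT; split=> //.
rewrite ew ew' !mulr0 mul0r !addr0; split=> [||_].
- by rewrite !mulr_ge0 ?powR_ge0.
- by rewrite !mulr_ge0 ?powR_ge0.
by rewrite ler_peMr ?mulr_ge0 // le_max lexx.
Qed.

(** A nonzero vector of error 0 has a primitive factor [w] of error 0. If all vectors of error 0
    were parallel to [w], they would be exactly its integer multiples, a one-dimensional lattice. *)
Lemma err_gt0_or_pinfty : ~ one_dim_lattice (integer_solutions Theta) ->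
  (forall w, w != 0 -> 0 < e w) \/ regular_exponent Theta 2 = +oo%E.
Proof.
move=> hL; have [|/existsNP[w1 /not_implyP[w10 /negP]]] :=
  pselect (forall w, w != 0 -> 0 < e w); first by left.
rewrite -leNgt => ew1; right; have [c [w [c0 w1E wp]]] := primitive_factor _ _ w10.
have {}ew1 : e w1 = 0 by apply/eqP; rewrite eq_le ew1 /=.
have ew : e w = 0.
  apply/eqP; move: ew1; rewrite /e w1E err_emb_scale => /eqP.
  by rewrite mulf_eq0 normr_eq0 intr_eq0 (negbTE c0).
have solE (x : 'cV[int]_m) (y : 'cV[int]_n) :
    integer_solutions Theta (x, y) <-> e (col_mx x y) = 0.
  rewrite /e /err /defect /emb map_col_mx col_mxKu col_mxKd /integer_solutions /=.
  split=> [->|/eqP]; first by rewrite subrr normr0.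
  by rewrite normr_eq0 subr_eq0 => /eqP.
have [par|/existsNP[w' /not_implyP[ew' /eqP ww0]]] :=
  pselect (forall w', e w' = 0 -> wedge (em w) (em w') = 0); last first.
  exact: regular_exponent2_pinfty ww0 ew ew'.
exfalso; apply: hL; exists (usubmx w, dsubmx w).
  apply: contraTneq (primitive_neq0 _ _ wp) => -[u0 d0].
  by rewrite negbK -(vsubmxK w) u0 d0 col_mx0.
have pairMz (a : 'cV[int]_m * 'cV[int]_n) (k : int) : a *~ k = (k *: a.1, k *: a.2).
  by rewrite [LHS]surjective_pairing !raddfMz -!scaler_int !intz.
apply/seteqP; split=> [[x y] /solE exy|_ [k _ <-]] /=.
  have [xy0|xy0] := eqVneq (col_mx x y) 0.
    exists 0 => //=; rewrite mulr0z; move/eqP: xy0; rewrite col_mx_eq0.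
    by move=> /andP[/eqP-> /eqP->].
  have [k _ kE] := primitive_wedge_eq0 w _ wp xy0 (par _ exy).
  exists k => //=; rewrite pairMz /=.
  have -> : k *: usubmx w = x by rewrite -[RHS](col_mxKu x y) kE linearZ.
  by have -> : k *: dsubmx w = y by rewrite -[RHS](col_mxKd x y) kE linearZ.
rewrite pairMz; apply/solE; rewrite /= -scale_col_mx vsubmxK /e err_emb_scale.
by rewrite -/(e w) ew mulr0.
Qed.

Hypothesis e_gt0 : forall w, w != 0 -> 0 < e w.

(** Only finitely many integer vectors have height at most [M] and error at most 1. *)
Lemma err_bounded_below (M : R) : exists2 d : R, 0 < d &
  forall w, w != 0 -> h w <= M -> d <= e w.
Proof.
have [C C1 CP] := ext_norm_lattice _ _ _ Theta.
have C0 : 0 <= C by rewrite (le_trans _ C1).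
pose N := (Num.truncn (C * (`|M| + 1))).+1.
(* [W] enumerates the integer points with coordinates from [-N] to [N] by a finite type; the default
   1 of the minimum below covers errors above 1. *)
pose W (f : {ffun 'I_(m + n) -> 'I_(N + N).+1}) : 'cV[int]_(m + n) :=
  \col_k ((f k)%:Z - N%:Z).
exists (\big[Num.min/1]_(f | W f != 0) e (W f)).
  by apply: lt_bigmin => // f /e_gt0.
move=> w w0 hM; have [e1|/ltW e1] := leP (e w) 1; last first.
  by apply: le_trans e1; exact: bigmin_le_id.
have wN k : (`|w k 0| < N%:Z)%R.
  rewrite -(ltr_int R) intr_norm; apply: le_lt_trans (truncnS_gt _).
  have -> : `|(w k 0)%:~R| = `|em w [set k]%SET|.
    rewrite ffunE (big_pred1 k) ?mxE // => l /=.
    by rewrite (inj_eq set1_inj) eq_sym.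
  apply: le_trans (ext_norm_ge _ _ _ _) _; apply: le_trans (CP _) _.
  rewrite ler_wpM2l // lerD //; exact: le_trans hM (ler_norm M).
pose f : {ffun 'I_(m + n) -> 'I_(N + N).+1} := [ffun k => inord (absz (w k 0 + N%:Z))].
have fE : W f = w.
  have shift (x : int) (K : nat) : `|x| < K%:Z ->
      (absz (x + K%:Z)%R < (K + K).+1)%N /\ (absz (x + K%:Z))%:Z - K%:Z = x by lia.
  apply/matrixP => k l; rewrite ord1 mxE ffunE.
  by have [xN xE] := shift _ _ (wN k); rewrite inordK.
by rewrite -fE in w0 *; apply: (bigmin_le_cond _ (fun f => e (W f))).
Qed.

(** [Y] is the height of the primitive [w], while [w'] has height at most [Y / 2], less than any
    nonzero integer multiple of [w]. *)
Lemma consecutive_points1 (a b : R) : 0 < b ->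
  (a%:E < uniform_exponent Theta 1)%E -> (b%:E < regular_exponent Theta 1)%E ->
  exists2 K : R, 1 <= K & forall M : R, exists Y w w',
    [/\ M <= Y, 1 <= Y, wedge (em w) (em w') != 0 &
     [/\ h w <= Y, e w <= Y `^ (- b), h w' <= Y & e w' <= K * Y `^ (- a)]].
Proof.
move=> b0 /(uniform_exponent1 _ _ _ _ _ m_gt0)[M0 M01 unif] /(regular_exponent1 _ _ _ _ _ m_gt0) reg.
(* The factor [2^-1 ^ (- a)] comes from using the uniform exponent at [Y / 2]; adding 1 secures
   [1 <= K]. *)
exists (1 + 2^-1 `^ (- a)) => [|M]; first by rewrite lerDl powR_ge0.
pose M1 := Num.max (2 * M0) (`|M| + 1).
have [d d0 dP] := err_bounded_below M1.
(* Beyond [T0] the power [t ^ b] exceeds [1 / d], so [e w < d] and the height of [w] is forced above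
   [M1]. *)
have [T0 T01 T0P] := powR_eventually_ge _ (d^-1 + 1) b b0.
have [t Mt [w0 [w00 hw0 ew0]]] := reg T0.
have [t1 Tt] : 1 <= t /\ T0 <= t by move: Mt; rewrite ge_max => /andP[].
have t0 : 0 < t by rewrite (lt_le_trans _ t1).
have [c [w [c0 w0E wp]]] := primitive_factor _ _ w00.
have hw : h w <= t.
  by apply: le_trans hw0; rewrite w0E height_emb_scale ler_peMl ?intr_norm_ge1 //.
have ew : e w <= t `^ (- b).
  by apply: le_trans ew0; rewrite w0E err_emb_scale ler_peMl ?intr_norm_ge1 //.
have ewd : e w < d.
  apply: le_lt_trans ew _; rewrite powRN -[ltRHS]invrK ltf_pV2 ?posrE ?invr_gt0 ?powR_gt0 //.
  by apply: lt_le_trans (T0P _ Tt); rewrite ltrDl.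
have : M1 < h w.
  by rewrite ltNge; apply/negP => /(dP _ (primitive_neq0 _ _ wp)); rewrite leNgt ewd.
rewrite gt_max => /andP[/ltW MY1 /ltW MY2].
have Y1 : 1 <= h w by apply: le_trans MY2; rewrite lerDr.
have Y0 : 0 < h w by rewrite (lt_le_trans _ Y1).
have [|w' [w'0 hw' ew']] := unif (h w / 2); first by rewrite ler_pdivlMr // mulrC.
exists (h w), w, w'; split=> //.
- by apply: le_trans MY2; rewrite ler_wpDr // ler_norm.
- apply/eqP => /(primitive_wedge_eq0 _ _ wp w'0)[c' c'0 w'E].
  move: hw'; rewrite w'E height_emb_scale leNgt => /negP; apply.
  apply: (@lt_le_trans _ _ (h w)); first by rewrite ltr_pdivrMr // ltr_pMr // ltr1n.
  by rewrite ler_peMl ?intr_norm_ge1.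
split=> //.
(* Passing to the primitive factor may shrink the height below [t], which only weakens the error
   bound, as [b > 0]. *)
- apply: le_trans ew _; rewrite !powRN lef_pV2 ?posrE ?powR_gt0 //.
  by apply: ge0_ler_powR; rewrite ?nnegrE ?(ltW b0) ?(ltW t0).
- by apply: le_trans hw' _; rewrite ler_pdivrMr // ler_peMr // ler1n.
apply: le_trans ew' _; rewrite powRM ?invr_ge0 // mulrC.
by rewrite ler_wpM2r ?powR_ge0 // lerDr.
Qed.

(** [S] is the inverse of the error of the primitive [w]; the error of [w'] is strictly smaller, so
    [w'] is no nonzero integer multiple of [w]. *)
Lemma consecutive_points2 (a b : R) : 0 < a -> 0 < b ->
  (a%:E < uniform_exponent Theta 1)%E -> (b%:E < regular_exponent Theta 1)%E ->
  forall M : R, exists S w w',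
    [/\ M <= S, 1 <= S, wedge (em w) (em w') != 0 &
     [/\ h w <= S `^ b^-1, e w <= S^-1, h w' <= 2 * S `^ a^-1 & e w' <= S^-1]].
Proof.
move=> a0 b0 /(uniform_exponent1 _ _ _ _ _ m_gt0)[M0 M01 unif] /(regular_exponent1 _ _ _ _ _ m_gt0) reg M.
have [T1 T11 T1P] := powR_eventually_ge _ M0 a^-1 ltac:(by rewrite invr_gt0).
have [T0 T01 T0P] := powR_eventually_ge _ (Num.max M T1) b b0.
have [t Mt [w0 [w00 hw0 ew0]]] := reg T0.
have [t1 Tt] : 1 <= t /\ T0 <= t by move: Mt; rewrite ge_max => /andP[].
have t0 : 0 < t by rewrite (lt_le_trans _ t1).
have [c [w [c0 w0E wp]]] := primitive_factor _ _ w00.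
have hw : h w <= t.
  by apply: le_trans hw0; rewrite w0E height_emb_scale ler_peMl ?intr_norm_ge1 //.
have ew : e w <= t `^ (- b).
  by apply: le_trans ew0; rewrite w0E err_emb_scale ler_peMl ?intr_norm_ge1 //.
have ew0' : 0 < e w by exact/e_gt0/(primitive_neq0 _ _ wp).
pose S := (e w)^-1; have S0 : 0 < S by rewrite invr_gt0.
have tS : t `^ b <= S.
  by rewrite /S -[leLHS]invrK lef_pV2 ?posrE ?invr_gt0 ?powR_gt0 // -powRN.
have : Num.max M T1 <= S by apply: le_trans tS; exact: T0P.
rewrite ge_max => /andP[MS T1S].
have S1 : 1 <= S by exact: le_trans T1S.
(* The factor 2 makes the error at most [2 ^ (- a) / S], strictly below [e w]. *)
have [|w' [w'0 hw' ew']] := unif (2 * S `^ a^-1).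
  by apply: le_trans (T1P _ T1S) _; rewrite ler_peMl ?powR_ge0 // ler1n.
have {}ew' : e w' < S^-1.
  apply: le_lt_trans ew' _; rewrite powRM ?powR_ge0 //.
  rewrite -powRrM mulrN mulVf ?lt0r_neq0 // powR_inv1 ?(ltW S0) //.
  rewrite gtr_pMl ?invr_gt0 // powRN invf_lt1 ?powR_gt0 //.
  rewrite [ltLHS](_ : _ = 1 `^ a); last by rewrite powR1.
  by apply: gt0_ltr_powR; rewrite ?nnegrE // ltr1n.
exists S, w, w'; split=> //.
  apply/eqP => /(primitive_wedge_eq0 _ _ wp w'0)[c' c'0 w'E].
  move: ew'; rewrite /e w'E err_emb_scale ltNge /S invrK => /negP; apply.
  by rewrite ler_peMl ?intr_norm_ge1.
split=> //; last exact: ltW.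
- apply: le_trans hw _; rewrite [leLHS](_ : _ = (t `^ b) `^ b^-1).
    by apply: ge0_ler_powR; rewrite ?nnegrE ?powR_ge0 ?invr_ge0 ?(ltW b0) ?(ltW S0).
  by rewrite -powRrM divff ?lt0r_neq0 // powRr1 // ltW.
by rewrite /S invrK.
Qed.

End Constructions.

(** * The three lower bounds for [a] and [b] strictly below the first exponents *)

Section Bounds.
Variables (R : realType) (m n : nat) (Theta : 'M[R]_(n, m)).
Hypothesis m_gt0 : (0 < m)%N.
Implicit Types (w : 'cV[int]_(m + n)).

Let h w := height R m n (emb R m n w).
Let e w := err R m n Theta (emb R m n w).
Let em w := ext_vec (emb R m n w).

Let h_ge0 w : 0 <= h w. Proof. exact: height_ge0. Qed.
Let e_ge0 w : 0 <= e w. Proof. exact: err_ge0. Qed.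

Hypothesis e_gt0 : forall w, w != 0 -> 0 < e w.
Variables (a b : R).
Hypotheses (a_gt0 : 0 < a) (ab : a <= b).
Hypothesis a_lt : (a%:E < uniform_exponent Theta 1)%E.
Hypothesis b_lt : (b%:E < regular_exponent Theta 1)%E.

Let b_gt0 : 0 < b. Proof. exact: lt_le_trans ab. Qed.

Lemma powR_mul (x u v : R) : 0 < x -> x `^ u * x `^ v = x `^ (u + v).
Proof. by move=> x0; rewrite powRD // (lt0r_neq0 x0) implybT. Qed.

Lemma consecutive_products1 : exists2 K : R, 0 <= K & forall M : R, exists Y w w',
  [/\ M <= Y, 1 <= Y, wedge (em w) (em w') != 0 &
   [/\ e w * e w' <= K * Y `^ (- (a + b)),
       h w * e w' + e w * h w' + e w * e w' <= K * Y `^ (1 - a) &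
       (h w + e w) * (h w' + e w') <= K * Y `^ 2]].
Proof.
have [K K1 KP] := consecutive_points1 _ _ _ _ m_gt0 e_gt0 _ _ b_gt0 a_lt b_lt.
have K0 : 0 <= K by rewrite (le_trans _ K1).
exists (4 * K) => [|M]; first by rewrite mulr_ge0.
have [Y [w [w' [MY Y1 ww0 [hw ew hw' ew']]]]] := KP M.
have Y0 : 0 < Y by rewrite (lt_le_trans _ Y1).
exists Y, w, w'; split=> //; rewrite -/(h w) -/(e w) -/(h w') -/(e w') in hw ew hw' ew' *.
have Yb : Y `^ (- b) <= 1 by rewrite powRN invf_le1 ?powR_gt0 // -[leLHS](powRr0 Y) ler_powR // ltW.
have Ya : Y `^ (- a) <= 1 by rewrite powRN invf_le1 ?powR_gt0 // -[leLHS](powRr0 Y) ler_powR // ltW.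
have ee : e w * e w' <= K * Y `^ (- (a + b)).
  rewrite opprD addrC -powR_mul // mulrCA; exact: ler_pM.
have Y1a : Y `^ (1 - a) = Y * Y `^ (- a) by rewrite -powR_mul // powRr1 // ltW.
have Yab : Y `^ (- (a + b)) <= Y `^ (1 - a).
  by apply: ler_powR => //; rewrite opprD addrC lerD2r (le_trans _ ler01) // oppr_le0 ltW.
have he : h w * e w' <= K * Y `^ (1 - a) by rewrite Y1a mulrCA; exact: ler_pM.
(* Since [a <= b], the factor [Y ^ (- b)] is at most [Y ^ (- a)], and this term has the order of the
   previous one. *)
have eh : e w * h w' <= K * Y `^ (1 - a).
  rewrite Y1a mulrC; apply: le_trans (ler_pM _ _ hw' ew) _ => //.
  rewrite mulrA [K * Y]mulrC -mulrA ler_wpM2l ?(ltW Y0) //.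
  apply: (@le_trans _ _ (Y `^ (- a))); first by rewrite ler_powR // lerN2.
  by rewrite ler_peMl ?powR_ge0.
split.
- apply: le_trans ee _; rewrite ler_wpM2r ?powR_ge0 //.
  by rewrite ler_peMl // ler1n.
- have ee' : e w * e w' <= K * Y `^ (1 - a).
    by apply: le_trans ee _; rewrite ler_wpM2l.
  have P0 : 0 <= K * Y `^ (1 - a) by rewrite mulr_ge0 ?powR_ge0.
  by lra.
have -> : Y `^ 2 = Y * Y by rewrite -(natr1 1) -powR_mul // powRr1 // ltW.
have ew1 : e w <= Y by apply: le_trans ew _; exact: le_trans Y1.
have ew2 : e w' <= K * Y.
  by apply: le_trans ew' _; rewrite ler_wpM2l //; exact: le_trans Y1.
have hw2 : h w' <= K * Y by apply: le_trans hw' _; rewrite ler_peMl // ltW.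
rewrite (_ : 4 * K * (Y * Y) = (2 * Y) * (2 * (K * Y))); last by ring.
by apply: ler_pM; rewrite ?addr_ge0 //; lra.
Qed.

Lemma regular_exponent2_ge1 : m = 1%N -> a < 1 ->
  (((a + b) / (1 - a))%:E <= regular_exponent Theta 2)%E.
Proof.
move=> m1 a1; have a10 : 0 < 1 - a by rewrite subr_gt0.
have [K K0 KP] := consecutive_products1.
apply: (@regular_exponent2_ge _ _ _ _ m_gt0 _ K) => // [|M].
  rewrite (lt_trans (ltrN10 _)) // divr_gt0 // addr_gt0 //; exact: lt_le_trans ab.
have [T0 T01 T0P] := powR_eventually_ge _ (Num.max M 1) _ a10.
have [Y [w [w' [TY Y1 ww0 [c2 c1 _]]]]] := KP T0.
have := T0P _ TY; rewrite ge_max => /andP[MT T1].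
(* Here [k0 = 0]: size 0 asks for [T = Y ^ (1 - a)] and size 1 for [T ^ (- g) = Y ^ (- (a + b))],
   both matched exactly. *)
exists (Y `^ (1 - a)), w, w'; split=> //.
have -> : (m - k0 m 2 = 1)%N by rewrite /k0; move: m1; clear; lia.
have -> : (m.-1 - k0 m 2 = 0)%N by rewrite /k0; move: m1; clear; lia.
rewrite -!powRrM; split=> [||m2].
- rewrite (_ : (1 - a) * _ = - (a + b)) //; field; exact: lt0r_neq0.
- by rewrite (_ : (1 - a) * _ = 1 - a) //; ring.
by exfalso; move: m2; rewrite m1.
Qed.

Lemma regular_exponent2_ge2 : (2 <= m)%N ->
  (((a - 1) / (2 + b - a))%:E <= regular_exponent Theta 2)%E.
Proof.
move=> m2; have d0 : 0 < 2 + b - a by move: ab; lra.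
have [K K0 KP] := consecutive_products1.
apply: (@regular_exponent2_ge _ _ _ _ m_gt0 _ K) => // [|M].
  by rewrite ltr_pdivlMr //; move: b_gt0; lra.
have [T0 T01 T0P] := powR_eventually_ge _ (Num.max M 1) _ d0.
have [Y [w [w' [TY Y1 ww0 [c2 c1 c0]]]]] := KP T0.
have := T0P _ TY; rewrite ge_max => /andP[MT T1].
(* For this power of [Y] sizes [m] and [m - 1] are matched exactly, and the third estimate amounts
   to [2 <= 2 + b - a]. *)
exists (Y `^ (2 + b - a)), w, w'; split=> //.
have -> : (m - k0 m 2 = 2)%N by rewrite /k0 subKn.
have -> : (m.-1 - k0 m 2 = 1)%N by rewrite /k0; move: m2; clear; lia.
rewrite -!powRrM; split.
- rewrite (_ : (2 + b - a) * _ = - (a + b)) //; field; exact: lt0r_neq0.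
- rewrite (_ : (2 + b - a) * _ = 1 - a) //; field; exact: lt0r_neq0.
move=> _; apply: le_trans c0 _; rewrite ler_wpM2l // ler_powR //.
by move: ab; lra.
Qed.

Lemma regular_exponent2_ge3 : (2 <= m)%N ->
  (((1 - a^-1) / (b^-1 + a^-1))%:E <= regular_exponent Theta 2)%E.
Proof.
move=> m2.
have ai : 0 < a^-1 by rewrite invr_gt0.
have bi : 0 < b^-1 by rewrite invr_gt0.
have ba : b^-1 <= a^-1 by rewrite lef_pV2.
have d0 : 0 < b^-1 + a^-1 by rewrite addr_gt0.
apply: (@regular_exponent2_ge _ _ _ _ m_gt0 _ 6) => // [|M].
  by rewrite ltr_pdivlMr //; move: bi; lra.
have [T0 T01 T0P] := powR_eventually_ge _ (Num.max M 1) _ d0.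
have [S [w [w' [TS S1 ww0 [hw ew hw' ew']]]]] :=
  consecutive_points2 _ _ _ _ m_gt0 e_gt0 _ _ a_gt0 b_gt0 a_lt b_lt T0.
rewrite -/(h w) -/(e w) -/(h w') -/(e w') in hw ew hw' ew'.
have := T0P _ TS; rewrite ge_max => /andP[MT T1].
have S0 : 0 < S by rewrite (lt_le_trans _ S1).
(* [T] has the order of the product of the two height bounds; size [m - 1] then asks for
   [S ^ (1 / a - 1)], the order attained, and size [m] has the factor [S ^ (1 / a - 1 / b)] to
   spare. *)
exists (S `^ (b^-1 + a^-1)), w, w'; split=> //.
rewrite -/(h w) -/(e w) -/(h w') -/(e w').
have -> : (m - k0 m 2 = 2)%N by rewrite /k0 subKn.
have -> : (m.-1 - k0 m 2 = 1)%N by rewrite /k0; move: m2; clear; lia.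
rewrite -!powRrM.
have -> : (b^-1 + a^-1) * (1 - 2%:R * (1 + (1 - a^-1) / (b^-1 + a^-1))) =
    a^-1 - b^-1 - 2.
  by rewrite mulrBr mulr1 mulrCA mulrDr mulr1 mulrCA divff ?lt0r_neq0 //; ring.
have -> : (b^-1 + a^-1) * (1 - 1%:R * (1 + (1 - a^-1) / (b^-1 + a^-1))) = a^-1 - 1.
  by rewrite mulrBr mulr1 mul1r mulrDr mulr1 mulrCA divff ?lt0r_neq0 //; ring.
have Sm1 : S^-1 = S `^ (- 1) by rewrite powR_inv1 // ltW.
have mono (u v : R) : u <= v -> S `^ u <= S `^ v by exact: ler_powR.
have ee : e w * e w' <= S `^ (- 2).
  have -> : - 2 = - 1 + - 1 :> R by ring.
  by rewrite -powR_mul // -Sm1 ler_pM.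
split=> [||_].
- apply: le_trans ee _; apply: (@le_trans _ _ (S `^ (a^-1 - b^-1 - 2))).
    by apply: mono; move: ba; lra.
  by rewrite ler_peMl ?powR_ge0 // ler1n.
- have he : h w * e w' <= S `^ (a^-1 - 1).
    apply: le_trans (ler_pM _ _ hw ew') _ => //.
    by rewrite Sm1 powR_mul // mono // lerD2r.
  have eh : e w * h w' <= 2 * S `^ (a^-1 - 1).
    rewrite mulrC; apply: le_trans (ler_pM _ _ hw' ew) _ => //.
    by rewrite Sm1 -mulrA powR_mul.
  have ee' : e w * e w' <= S `^ (a^-1 - 1).
    by apply: le_trans ee _; apply: mono; move: ai; lra.
  have := powR_ge0 S (a^-1 - 1); move: he eh ee'.
  move: (S `^ _) => P; lra.
rewrite -powR_mul //.
have Sa : S `^ (- 1) <= S `^ a^-1 by apply: mono; move: ai; lra.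
have Sb : S `^ (- 1) <= S `^ b^-1 by apply: mono; move: bi; lra.
rewrite Sm1 in ew ew'.
(* The factors [h w + e w] and [h w' + e w'] account for 2 and 3 respectively. *)
rewrite (_ : 6 * _ = (2 * S `^ b^-1) * (3 * S `^ a^-1)); last by ring.
move: (S `^ _) (S `^ a^-1) (S `^ b^-1) hw ew hw' ew' Sa Sb => P A B *.
by apply: ler_pM; rewrite ?addr_ge0 //; lra.
Qed.

End Bounds.

(** * Passage to the limit in the extended reals *)

Section ExponentLimits.
Local Open Scope ereal_scope.
Variable R : realType.
Implicit Types (a b c : \bar R) (x y g : R).

(** One admissible point excludes [c = -oo] in the three limits; [x < 1] keeps the denominator
    [1 - x] positive in the first. *)
Lemma exists_below2 a b : 0 < a -> a <= b ->
  exists x, [/\ (0 < x)%R, (x < 1)%R, x%:E < a & x%:E < b].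
Proof.
move=> a0 ab.
suff [x [x0 x1 xa]] : exists x, [/\ (0 < x)%R, (x < 1)%R & x%:E < a].
  by exists x; split=> //; exact: lt_le_trans ab.
case: a a0 {ab} => [r| |] // r0; last by exists (2^-1)%R; rewrite ltry; split=> //; lra.
exists (Num.min 1 r / 2)%R; rewrite lte_fin in r0 *.
have m0 : (0 < Num.min 1 r)%R by rewrite lt_min ltr01.
have m1 : (Num.min 1 r <= 1)%R by rewrite ge_min lexx.
have mr : (Num.min 1 r <= r)%R by rewrite ge_min lexx orbT.
by rewrite lte_fin; split; lra.
Qed.

Lemma div_EFin x y : y != 0%R -> x%:E / y%:E = (x / y)%:E.
Proof. by move=> y0; rewrite inver (negbTE y0). Qed.

Lemma limit_case1 a b c : 0 < a -> a <= b ->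
  (forall x y, (0 < x)%R -> (x < 1)%R -> (x <= y)%R -> x%:E < a -> y%:E < b ->
    ((x + y) / (1 - x))%:E <= c) ->
  (b + a) / (1 - a) <= c.
Proof.
move=> a0 ab H; have [x0 [x00 x01 x0a x0b]] := exists_below2 _ _ a0 ab.
case: c H => [g| |] H; [|by rewrite leey|by have := H _ _ x00 x01 (lexx _) x0a x0b].
have {}H x y : (0 < x)%R -> (x < 1)%R -> (x <= y)%R -> x%:E < a -> y%:E < b ->
    (x + y <= g * (1 - x))%R.
  move=> x0' x1 xy xa yb; have := H x y x0' x1 xy xa yb.
  by rewrite lee_fin ler_pdivrMr // subr_gt0.
have [a1|a1] := leP 1 a.
  (* No real [c] is possible when [a >= 1]: [x = y = 1 - d] would give [2 <= (2 + g) * d <= 1]. *)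
  pose d := (2 + `|g|)^-1%R.
  have d0 : (0 < d)%R by rewrite invr_gt0 ltr_pwDl.
  have dE : (2 * d + `|g| * d = 1)%R by rewrite -mulrDl divff // lt0r_neq0 // ltr_pwDl.
  have gd : (0 <= `|g| * d)%R by rewrite mulr_ge0 // ltW.
  have ggd : (g * d <= `|g| * d)%R by rewrite ler_wpM2r ?ler_norm // ltW.
  have da : (1 - d)%:E < a by apply: lt_le_trans a1; rewrite lte_fin gtrBl.
  have := H (1 - d)%R (1 - d)%R _ _ (lexx _) da (lt_le_trans da ab).
  rewrite subKr subr_gt0 gtrBl d0 => H1.
  have : (1 - d + (1 - d) <= g * d)%R by apply: H1 => //; lra.
  by move=> ?; suff: (0 < 0 :> R)%R; [rewrite ltxx|lra].
case: a a0 ab a1 x0a H => [r| |] // r0 ab r1 x0r H.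
rewrite !lte_fin in r0 r1 x0r.
have r1' : (0 < 1 - r)%R by rewrite subr_gt0.
case: b ab x0b H => [s| |] // ab x0b H; last first.
  (* Here [b = +oo], and [y] is so large that [x0 + y] exceeds [g * (1 - x0)], a contradiction. *)
  have := H x0 (x0 + `|g * (1 - x0)|)%R x00 x01 _ _ _.
  rewrite lerDl normr_ge0 lte_fin ltry => /(_ isT x0r isT).
  have := ler_norm (g * (1 - x0))%R.
  by move: (g * _)%R `|_|%R => u v *; suff: (0 < 0 :> R)%R; [rewrite ltxx|lra].
rewrite !lee_fin in ab; rewrite -EFinD -EFinB div_EFin ?lt0r_neq0 // lee_fin.
rewrite ler_pdivrMr //; apply/ler_addgt0Pr => e e0.
(* Lowering both arguments by [k] costs [(2 + g) * k <= e]; [k <= r / 2] keeps [r - k] positive. *)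
pose k := (Num.min (e / (2 + `|g|)) (r / 2))%R.
have g2 : (0 < 2 + `|g|)%R by rewrite ltr_pwDl.
have k0 : (0 < k)%R by rewrite lt_min !divr_gt0.
have ke : ((2 + `|g|) * k <= e)%R.
  by rewrite mulrC -ler_pdivlMr // ge_min lexx.
have kr : (k <= r / 2)%R by rewrite ge_min lexx orbT.
have gk : (g * k <= `|g| * k)%R by rewrite ler_wpM2r ?ler_norm // ltW.
have := H (r - k)%R (s - k)%R; rewrite !lte_fin !gtrBl k0 lerD2r => H1.
have : (r - k + (s - k) <= g * (1 - (r - k)))%R by apply: H1 => //; lra.
by lra.
Qed.

Lemma limit_case2 a b c : 0 < a -> a <= b -> a != +oo ->
  (forall x y, (0 < x)%R -> (x <= y)%R -> x%:E < a -> y%:E < b ->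
    ((x - 1) / (2 + y - x))%:E <= c) ->
  (a - 1) / (2%:E + b - a) <= c.
Proof.
move=> a0 ab ay H; have [x0 [x00 x01 x0a x0b]] := exists_below2 _ _ a0 ab.
case: c H => [g| |] H; [|by rewrite leey|by have := H _ _ x00 (lexx _) x0a x0b].
have {}H x y : (0 < x)%R -> (x <= y)%R -> x%:E < a -> y%:E < b ->
    (x - 1 <= g * (2 + y - x))%R.
  move=> x0' xy xa yb; have := H x y x0' xy xa yb.
  by rewrite lee_fin ler_pdivrMr //; lra.
case: a a0 ab ay x0a H => [r| |] // r0 ab _ x0r H.
rewrite !lte_fin in r0 x0r.
case: b ab x0b H => [s| |] // ab x0b H; last first.
  (* For [b = +oo] the left side is 0. A negative [g] is refuted by [y = x0 + N], since then
     [g * (2 + N) = 2 * g - |x0 - 1|] is below [x0 - 1]. *)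
  rewrite addey // addye // invey mule0 lee_fin leNgt; apply/negP => g0.
  have ng : (0 < - g)%R by rewrite oppr_gt0.
  pose N := (`|x0 - 1| / - g)%R.
  have N0 : (0 <= N)%R by rewrite divr_ge0 // ltW.
  have gN : (g * N = - `|x0 - 1|)%R by rewrite -[g]opprK mulNr mulrC divfK ?lt0r_neq0.
  have := H x0 (x0 + N)%R x00; rewrite lerDl lte_fin ltry => /(_ N0 x0r isT).
  have -> : (2 + (x0 + N) - x0 = 2 + N)%R by ring.
  have := ler_norm (- (x0 - 1))%R; rewrite normrN mulrDr gN.
  by move: `|_|%R => *; lra.
rewrite !lee_fin in ab; rewrite -EFinD -!EFinB div_EFin; last by rewrite lt0r_neq0 //; lra.
rewrite lee_fin ler_pdivrMr; last by lra.
(* A common shift leaves the denominator unchanged, so only the numerator loses [k]. *)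
apply/ler_addgt0Pr => e e0; pose k := (Num.min e (r / 2))%R.
have k0 : (0 < k)%R by rewrite lt_min e0 divr_gt0.
have ke : (k <= e)%R by rewrite ge_min lexx.
have kr : (k <= r / 2)%R by rewrite ge_min lexx orbT.
have := H (r - k)%R (s - k)%R; rewrite !lte_fin !gtrBl k0 lerD2r => H1.
have : (r - k - 1 <= g * (2 + (s - k) - (r - k)))%R by apply: H1 => //; lra.
have -> : (2 + (s - k) - (r - k) = 2 + s - r)%R by ring.
by lra.
Qed.

Lemma limit_case3 a b c : 0 < a -> a <= b ->
  (forall x y, (0 < x)%R -> (x <= y)%R -> x%:E < a -> y%:E < b ->
    ((1 - x^-1) / (y^-1 + x^-1))%:E <= c) ->
  (1 - a^-1) / (b^-1 + a^-1) <= c.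
Proof.
move=> a0 ab H; have [x0 [x00 x01 x0a x0b]] := exists_below2 _ _ a0 ab.
case: c H => [g| |] H; [|by rewrite leey|by have := H _ _ x00 (lexx _) x0a x0b].
have {}H x y : (0 < x)%R -> (x <= y)%R -> x%:E < a -> y%:E < b ->
    (1 - x^-1 <= g * (y^-1 + x^-1))%R.
  move=> x0' xy xa yb; have := H x y x0' xy xa yb.
  by rewrite lee_fin ler_pdivrMr // addr_gt0 ?invr_gt0 // (lt_le_trans x0').
case: a a0 ab x0a H => [r| |] // r0 ab x0r H; last first.
  case: b ab x0b H => [s| |] // _ _ H.
  (* Here [a = b = +oo], and [x = y = N] would give [N - 1 <= 2 * g], impossible for this [N]. *)
  pose N := (2 * `|g| + 2)%R.
  have N0 : (0 < N)%R by rewrite ltr_wpDl // mulr_ge0.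
  have := H N N N0 (lexx _) (ltry _) (ltry _).
  rewrite -(ler_pM2r N0) mulrBl mul1r mulVf ?lt0r_neq0 // -mulrA mulrDl mulVf ?lt0r_neq0 //.
  have := ler_norm g; rewrite /N.
  by move: `|_|%R => *; suff: (0 < 0 :> R)%R; [rewrite ltxx|lra].
rewrite !lte_fin in r0 x0r.
pose A := r^-1%R; have A0 : (0 < A)%R by rewrite invr_gt0.
(* [B] plays [1 / b] (0 if [b] is infinite); [r (1 - k)] and [y k] are the
   approximations of [a] and [b] as [k] tends to 0. *)
have scale (B : R) (y : R -> R) : (0 <= B)%R ->
    (forall k : R, (0 < k)%R -> (k < 1)%R -> (r * (1 - k) <= y k)%R /\ (y k)%:E < b /\
        ((y k)^-1 * (1 - k) <= B + k)%R /\ (B <= (y k)^-1 * (1 - k) + k)%R) ->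
    (1 - A <= g * (B + A))%R.
  move=> B0 yP; apply/ler_addgt0Pr => e e0.
  pose k := (Num.min (e / (1 + `|g|)) 2^-1)%R.
  have g1 : (0 < 1 + `|g|)%R by rewrite ltr_pwDl.
  have k0 : (0 < k)%R by rewrite lt_min invr_gt0 ltr0n divr_gt0.
  have ke : ((1 + `|g|) * k <= e)%R by rewrite mulrC -ler_pdivlMr // ge_min lexx.
  have k2 : (k <= 2^-1)%R by rewrite ge_min lexx orbT.
  have k1 : (k < 1)%R by lra.
  have [ry [yb [yB By]]] := yP k k0 k1.
  have k1' : (0 < 1 - k)%R by rewrite subr_gt0.
  have rk0 : (0 < r * (1 - k))%R by rewrite mulr_gt0.
  have := H (r * (1 - k))%R (y k) rk0 ry _ yb.
  rewrite lte_fin gtr_pMr // gtrBl => /(_ k0).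
  (* Multiplying by [1 - k] turns the inverse of [r * (1 - k)] into [A]. *)
  rewrite -(ler_pM2r k1') mulrBl mul1r invfM -mulrA mulVf ?lt0r_neq0 // mulr1 -/A.
  rewrite -mulrA mulrDl -mulrA mulVf ?lt0r_neq0 // mulr1 => H1.
  have D : (`|(y k)^-1 * (1 - k) - B| <= k)%R.
    by move: yB By; rewrite ler_norml; move: (_ * (1 - k))%R => u *; apply/andP; split; lra.
  have : (g * ((y k)^-1 * (1 - k) - B) <= `|g| * k)%R.
    by apply: le_trans (ler_norm _) _; rewrite normrM ler_wpM2l.
  move: H1 ke; rewrite mulrDr mulrBr mulrDl mul1r.
  by move: (_^-1 * _)%R => u; lra.
case: b ab x0b H scale => [s| |] // ab x0b H scale.
  rewrite lee_fin in ab; have s0 : (0 < s)%R by exact: lt_le_trans ab.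
  have B0 : (0 < s^-1)%R by rewrite invr_gt0.
  rewrite !inver !gt_eqF // -EFinB -EFinD div_EFin ?lt0r_neq0 ?addr_gt0 //.
  rewrite lee_fin ler_pdivrMr ?addr_gt0 //; apply: (scale _ (fun k => s * (1 - k))%R).
    exact: ltW.
  move=> k k0 k1; have k1' : (0 < 1 - k)%R by rewrite subr_gt0.
  rewrite lte_fin gtr_pMr // gtrBl k0 ler_wpM2r // ?(ltW k1') //.
  rewrite invfM -mulrA mulVf ?lt0r_neq0 // mulr1.
  by rewrite !lerDl !(ltW k0).
rewrite invey add0e !inver !gt_eqF // -EFinB div_EFin ?lt0r_neq0 //.
rewrite lee_fin ler_pdivrMr // -[X in (g * X)%R]add0r.
(* For infinite [b] this choice has inverse at most [k] and stays above [r * (1 - k)]. *)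
apply: (scale _ (fun k => r + k^-1)%R) => // k k0 k1.
have ki : (0 < k^-1)%R by rewrite invr_gt0.
have y0 : (0 < r + k^-1)%R by rewrite addr_gt0.
rewrite ltry add0r; split; [|split=> //; split].
- apply: (@le_trans _ _ r); last by rewrite lerDl ltW.
  by rewrite ler_piMr ?(ltW r0) // gerBl ltW.
- apply: (@le_trans _ _ (r + k^-1)^-1%R).
    by rewrite ler_piMr ?invr_ge0 ?(ltW y0) // gerBl ltW.
  by rewrite -[leRHS]invrK lef_pV2 ?posrE // lerDr ltW.
by rewrite addr_ge0 ?(ltW k0) // mulr_ge0 ?invr_ge0 ?(ltW y0) // subr_ge0 ltW.
Qed.

End ExponentLimits.

(** * The inequalities between the exponents themselves *)

Local Open Scope ereal_scope.

(* MathComp-Analysis world. In \bar R: 0^-1 = +oo and (+oo)^-1 = 0. *)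
Theorem theorem2 (R : realType) (m n : nat)
    (hm : (1 <= m)%N) (hn : (1 <= n)%N) (hd : (3 <= m + n)%N)
    (Theta : 'M[R]_(n, m))
    (hL : ~ one_dim_lattice (integer_solutions Theta)) :
  let a1 := uniform_exponent Theta 1 in
  let b1 := regular_exponent Theta 1 in
  let b2 := regular_exponent Theta 2 in
  (m = 1%N -> (b1 + a1) / (1 - a1) <= b2) /\
  ((2 <= m)%N ->
    (a1 != +oo -> (a1 - 1) / (2%:E + b1 - a1) <= b2) /\
    (1 - a1^-1) / (b1^-1 + a1^-1) <= b2).
Proof.
move=> a1 b1 b2.
have [e_gt0|b2y] := err_gt0_or_pinfty _ _ _ Theta hm hL; last first.
  by rewrite /b2 b2y; split=> *; rewrite ?leey.
have a0 : 0 < a1 by exact: uniform_exponent_gt0.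
have ab : a1 <= b1 by exact: uniform_le_regular.
split=> [m1|m2].
  apply: limit_case1 => // x y x0 x1 xy xa yb.
  exact: (regular_exponent2_ge1 _ _ _ Theta hm e_gt0 x y).
split=> [ay|].
  apply: limit_case2 => // x y x0 xy xa yb.
  exact: (regular_exponent2_ge2 _ _ _ Theta hm e_gt0 x y).
apply: limit_case3 => // x y x0 xy xa yb.
exact: (regular_exponent2_ge3 _ _ _ Theta hm e_gt0 x y).
Qed.
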